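(* Let $\mathfrak l$ be an abelian Lie algebra and $(\mathfrak a,\omega_{\mathfrak a})$ a symplectic Lie algebra. The assignment $[\gamma,\epsilon,\xi]\mapsto$ (equivalence class of $\mathfrak d_{\gamma,\epsilon,\xi}(\mathfrak l,\mathfrak a)$) is a bijection from $H^2(\mathfrak l,\mathfrak a,\omega_{\mathfrak a})$ onto the set of equivalence classes of quadratic extensions of $\mathfrak l$ by $(\mathfrak a,\omega_{\mathfrak a})$. Moreover, it restricts to a bijection from $H^2(\mathfrak l,\mathfrak a,\omega_{\mathfrak a})_\sharp$ onto the set of equivalence classes of balanced quadratic extensions of $\mathfrak l$ by $(\mathfrak a,\omega_{\mathfrak a})$.
   Context: All vector spaces and Lie algebras are real and finite-dimensional. A symplectic Lie algebra $(\mathfrak g,\omega)$ is a Lie algebra $\mathfrak g$ with a skew-symmetric non-degenerate bilinear form $\omega$ such that $\omega([X,Y],Z)+\omega([Y,Z],X)+\omega([Z,X],Y)=0$ for all $X,Y,Z$. An isomorphism of symplectic Lie algebras is a Lie algebra isomorphism $\varphi$ with $\varphi^*\omega_2=\omega_1$. Orthogonal complements ${}^\perp$ are with respect to $\omega$. A quadratic extension of an abelian Lie algebra $\mathfrak l$ by a symplectic Lie algebra $(\mathfrak a,\omega_{\mathfrak a})$ is a tuple $(\mathfrak g,\mathfrak j,i,p)$, where $(\mathfrak g,\omega_{\mathfrak g})$ is a symplectic Lie algebra with center $\mathfrak z$, $\mathfrak j\subset\mathfrak z$ is an isotropic ideal of $\mathfrak g$, and $i,p$ are Lie algebra homomorphisms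 forming a short exact sequence $0\to\mathfrak a\xrightarrow{i}\mathfrak g/\mathfrak j\xrightarrow{p}\mathfrak l\to0$ such that $\operatorname{im} i=\mathfrak j^\perp/\mathfrak j$ and $i:\mathfrak a\to\mathfrak j^\perp/\mathfrak j$ is an isomorphism of symplectic Lie algebras (for the induced form). It is balanced if $\mathfrak j=\mathfrak z\cap\mathfrak z^\perp$. Two quadratic extensions $(\mathfrak g_k,\mathfrak j_k,i_k,p_k)$, $k=1,2$, of $\mathfrak l$ by $\mathfrak a$ are equivalent if there is an isomorphism $\Phi:\mathfrak g_1\to\mathfrak g_2$ of symplectic Lie algebras with $\Phi(\mathfrak j_1)=\mathfrak j_2$ whose induced map $\overline\Phi:\mathfrak g_1/\mathfrak j_1\to\mathfrak g_2/\mathfrak j_2$ satisfies $\overline\Phi\circ i_1=i_2$ and $p_2\circ\overline\Phi=p_1$. Let $\gamma:\mathfrak l\to\operatorname{Hom}(\mathfrak a,\mathfrak l^* )$ and $\xi:\mathfrak l\to\operatorname{Hom}(\mathfrak a,\mathfrak a)$ be linear and $\epsilon:\mathfrak l\times\mathfrak l\to\mathfrak l^*$ alternating bilinear. Write $\gamma(L_1,A,L_2):=(\gamma(L_1)(A))(L_2)$. Define alternating bilinear maps $\alpha:\mathfrak l\times\mathfrak l\to\mathfrak a$, $\beta:\mathfrak a\times\mathfrak a\to\mathfrak l^*$ by $$\omega_{\mathfrak a}(\alpha(L_1,L_2),A)=\gamma(L_1,A,L_2)-\gamma(L_2,A,L_1),\qquad \beta(A_1,A_2)(L)=-\omega_{\mathfrak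 a}(\xi(L)A_1,A_2)-\omega_{\mathfrak a}(A_1,\xi(L)A_2).$$ $Z^2(\mathfrak l,\mathfrak a,\omega_{\mathfrak a})$ is the set of such triples with, for all $L,L_i\in\mathfrak l$, $A,A_i\in\mathfrak a$: (1) every $\xi(L)$ is a derivation of $\mathfrak a$, $\xi(L_1)\xi(L_2)-\xi(L_2)\xi(L_1)=\operatorname{ad}_{\mathfrak a}(\alpha(L_1,L_2))$, and $\xi(L_1)\alpha(L_2,L_3)+\xi(L_2)\alpha(L_3,L_1)+\xi(L_3)\alpha(L_1,L_2)=0$; (2) $\beta(\xi(L)A_1,A_2)+\beta(A_1,\xi(L)A_2)=\gamma(L)[A_1,A_2]_{\mathfrak a}$; (3) $\gamma(L_2)(\xi(L_1)A)-\gamma(L_1)(\xi(L_2)A)+\beta(\alpha(L_1,L_2),A)=0$; (4) $\gamma(L_1)\alpha(L_2,L_3)+\gamma(L_2)\alpha(L_3,L_1)+\gamma(L_3)\alpha(L_1,L_2)=0$; (5) $\epsilon(L_1,L_2)L_3+\epsilon(L_2,L_3)L_1+\epsilon(L_3,L_1)L_2=0$. For $(\gamma,\epsilon,\xi)\in Z^2(\mathfrak l,\mathfrak a,\omega_{\mathfrak a})$, $\mathfrak d_{\gamma,\epsilon,\xi}(\mathfrak l,\mathfrak a)$ is the symplectic Lie algebra $\mathfrak l^*\oplus\mathfrak a\oplus\mathfrak l$ with brackets $[\mathfrak l^*,\cdot]=0$, $[A_1,A_2]=\beta(A_1,A_2)+[A_1,A_2]_{\mathfrak a}$, $[L,A]=\gamma(L)A+\xi(L)A$,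 $[L_1,L_2]=\epsilon(L_1,L_2)+\alpha(L_1,L_2)$ and form $\omega(Z_1+A_1+L_1,Z_2+A_2+L_2)=Z_1(L_2)+\omega_{\mathfrak a}(A_1,A_2)-Z_2(L_1)$. The same symbol denotes the quadratic extension $(\mathfrak d_{\gamma,\epsilon,\xi}(\mathfrak l,\mathfrak a),\mathfrak l^*,i,p)$ of $\mathfrak l$ by $\mathfrak a$, where $\mathfrak d_{\gamma,\epsilon,\xi}(\mathfrak l,\mathfrak a)/\mathfrak l^*$ is identified with $\mathfrak a\oplus\mathfrak l$ and $i,p$ are the canonical embedding and projection. $Z^2(\mathfrak l,\mathfrak a,\omega_{\mathfrak a})_\sharp$ is the set of $(\gamma,\epsilon,\xi)\in Z^2(\mathfrak l,\mathfrak a,\omega_{\mathfrak a})$ such that (a) $L=0$ is the only $L\in\mathfrak l$ for which there is an $A\in\mathfrak a$ satisfying simultaneously $\operatorname{ad}_{\mathfrak a}(A)+\xi(L)=0$, $\gamma(L)+\beta(A,\cdot)=0$, $\alpha(L,L')=\xi(L')A$ and $\epsilon(L,L')=\gamma(L')A$ for all $L'\in\mathfrak l$; (b) the subspace $\{A\in\mathfrak z(\mathfrak a): \beta(A,\cdot)=0,\ \xi(L)A=0,\ \gamma(L)A=0\ \forall L\in\mathfrak l\}$ of $\mathfrak a$ is non-degenerate with respect to $\omega_{\mathfrak a}$ (the zero subspace counts as non-degenerate). The additive group $C^1(\mathfrak l,\mathfrak a)=\operatorname{Hom}(\mathfrak l,\mathfrak a)$ acts on triples by $(\gamma,\epsilon,\xi)\tau=(\gamma',\epsilon',\xi')$,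 where, with $\tau^*:\mathfrak a\to\mathfrak l^*$, $\tau^*(A)(L)=\omega_{\mathfrak a}(\tau L,A)$, $\xi'(L)A=\xi(L)A-[\tau L,A]_{\mathfrak a}$, $\gamma'(L)A=\gamma(L)A+\tau^*(\xi(L)A)-\tau^*([\tau L,A]_{\mathfrak a})-\beta(\tau L,A)$, $\epsilon'(L_1,L_2)=\epsilon(L_1,L_2)+\tau^*(\alpha(L_1,L_2))-\gamma(L_1)(\tau L_2)+\gamma(L_2)(\tau L_1)-\tau^*(\xi(L_1)\tau L_2-\xi(L_2)\tau L_1)+\tau^*([\tau L_1,\tau L_2]_{\mathfrak a})+\beta(\tau L_1,\tau L_2)$. This action preserves $Z^2(\mathfrak l,\mathfrak a,\omega_{\mathfrak a})$ and $Z^2(\mathfrak l,\mathfrak a,\omega_{\mathfrak a})_\sharp$; the orbit spaces are denoted $H^2(\mathfrak l,\mathfrak a,\omega_{\mathfrak a})$ and $H^2(\mathfrak l,\mathfrak a,\omega_{\mathfrak a})_\sharp$, and $[\gamma,\epsilon,\xi]$ denotes the class of $(\gamma,\epsilon,\xi)$. *)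

(* Defs.v *)
From HB Require Import structures.
From mathcomp Require Import all_boot all_order all_algebra.
From mathcomp Require Import sesquilinear ring_quotient generic_quotient.
From mathcomp Require Import reals.
From mathcomp Require Import ring lra.

Set Implicit Arguments.
Unset Strict Implicit.
Unset Printing Implicit Defensive.

Import Order.TTheory GRing.Theory Num.Theory.

Local Open Scope ring_scope.
Local Open Scope quotient_scope.

Lemma scalar_inj (R : realType) (V : vectType R) (x y : V) :
  (forall f : {scalar V}, f x = f y) -> x = y.
Proof.
move=> h; rewrite (coord_vbasis (memvf x)) (coord_vbasis (memvf y)).
by apply: eq_bigr => i _; rewrite h.
Qed.

Section VectorQuotient.
Variables (R : realType) (V : vectType R) (U : {vspace V}).

(* MathComp's additive quotient by U, promoted to a vectType. *)
Definition vquot := Quotient.quot U.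

HB.instance Definition _ := ZmodQuotient.on vquot.

Lemma vquot_eqE (x y : V) : (\pi_vquot x == \pi_vquot y) = (x - y \in U).
Proof. by rewrite Quotient.idealrBE. Qed.

Lemma vquot_repr (x : V) : repr (\pi_vquot x) - x \in U.
Proof. by rewrite -vquot_eqE reprK. Qed.

Definition vquot_scale (k : R) (q : vquot) : vquot :=
  \pi_vquot (k *: repr q).

Lemma pi_scale k (x : V) : vquot_scale k (\pi_vquot x) = \pi_vquot (k *: x).
Proof.
apply/eqP; rewrite /vquot_scale vquot_eqE -scalerBr.
by apply: rpredZ; apply: vquot_repr.
Qed.

Fact vquot_scaleA a b q :
  vquot_scale a (vquot_scale b q) = vquot_scale (a * b) q.
Proof.
rewrite -[q]reprK; move: (repr q) => x.
by rewrite (pi_scale b x) !pi_scale scalerA.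
Qed.

Fact vquot_scale1 : left_id 1 vquot_scale.
Proof. by move=> q; rewrite -[q]reprK pi_scale scale1r. Qed.

Fact vquot_scaleDr : right_distributive vquot_scale +%R.
Proof.
move=> k p q; rewrite -[p]reprK -[q]reprK -raddfD !pi_scale scalerDr.
exact: raddfD.
Qed.

Fact vquot_scaleDl q : {morph vquot_scale^~ q : a b / a + b}.
Proof. by move=> a b; rewrite /vquot_scale scalerDl; apply: raddfD. Qed.

HB.instance Definition _ := GRing.Zmodule_isLmodule.Build R vquot
  vquot_scaleA vquot_scale1 vquot_scaleDr vquot_scaleDl.


Fact pi_vquot_linear : linear (\pi_vquot : V -> vquot).
Proof.
by move=> k x y; rewrite raddfD; congr (_ + _); exact/esym/(pi_scale k x).
Qed.
HB.instance Definition _ :=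
  GRing.isLinear.Build R V vquot *:%R \pi_vquot pi_vquot_linear.

(* Coordinates of the class of x: those of its representative in U^C. *)
Let vquot_sec (q : vquot) : V := repr q - projv U (repr q).

Let vquot_secE x : vquot_sec (\pi_vquot x) = x - projv U x.
Proof.
apply/eqP; rewrite /vquot_sec; set y := repr _.
rewrite -subr_eq0 [- (x - _)]opprD addrACA -opprD -linearB/= projv_id ?subrr//.
exact: vquot_repr.
Qed.

Let vquot_secP k p q :
  vquot_sec (k *: p + q) = k *: vquot_sec p + vquot_sec q.
Proof.
rewrite -[p]reprK -[q]reprK -linearP !vquot_secE.
by rewrite linearP scalerBr opprD addrACA.
Qed.

Fact vquot_vect_iso : Vector.axiom (\dim U^C) vquot.
Proof.
exists (fun q => \row_i coord (vbasis U^C) i (vquot_sec q)).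
  by move=> k p q; apply/rowP=> i; rewrite !mxE vquot_secP linearP.
exists (fun w : 'rV_(\dim U^C) =>
          \pi_vquot (\sum_i w 0 i *: (vbasis U^C)`_i)) => [q|w].
  rewrite -[RHS]reprK; set x := repr q.
  rewrite (eq_bigr (fun i => coord (vbasis U^C) i (vquot_sec q) *:
                             (vbasis U^C)`_i)); last by move=> i _; rewrite mxE.
  rewrite -coord_vbasis ?memv_projC//.
  by apply/eqP; rewrite vquot_eqE addrAC subrr add0r rpredN memv_proj.
have wU : \sum_i w 0 i *: (vbasis U^C)`_i \in (U^C)%VS.
  apply: rpred_sum => i _.
  by rewrite rpredZ// vbasis_mem// mem_nth// size_tuple.
apply/rowP=> i; rewrite mxE vquot_secE.
have projC0 v : v \in (U^C)%VS -> projv U v = 0.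
  by move=> vU; apply/eqP; rewrite -memv_ker lker_proj.
by rewrite projC0// subr0 coord_sum_free// (basis_free (vbasisP _)).
Qed.
HB.instance Definition _ := Lmodule_hasFinDim.Build R vquot vquot_vect_iso.

Definition vquot_proj : 'Hom(V, vquot) := linfun \pi_vquot.

(* The map induced on the quotient; meaningful when U lies in lker f. *)
Definition vquot_desc (W : vectType R) (f : 'Hom(V, W)) : 'Hom(vquot, W) :=
  linfun (fun q : vquot => f (repr q)).

Lemma vquot_projE x : vquot_proj x = \pi_vquot x.
Proof. exact: lfunE. Qed.

Lemma vquot_descE (W : vectType R) (f : 'Hom(V, W)) x :
  (U <= lker f)%VS -> vquot_desc f (vquot_proj x) = f x.
Proof.
move=> /subvP fU.
have fpi y : f (repr (\pi_vquot y)) = f y.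
  by apply/eqP; rewrite -subr_eq0 -linearB -memv_ker fU// vquot_repr.
pose g (q : vquot) := f (repr q).
have glin : linear g.
  by move=> k p q; rewrite -[p]reprK -[q]reprK -linearP /g !fpi linearP.
pose gL : {linear vquot -> W} :=
  HB.pack g (GRing.isLinear.Build R vquot W *:%R g glin).
by rewrite vquot_projE -[RHS]fpi; apply: (lfunE gL).
Qed.

End VectorQuotient.

Section Bilinear.
Variables (R : realType) (U V W : vectType R).

(* Bilinear maps U x V -> W are encoded as linear maps U -> Hom(V, W). *)
Definition bilin (f : U -> V -> W) : 'Hom(U, 'Hom(V, W)) :=
  linfun (fun x => linfun (f x)).

(* The side condition under which bilin f is really f (lemma bilinE). *)
Definition is_bilin (f : U -> V -> W) :=
  (forall y, linear (f^~ y)) /\ (forall x, linear (f x)).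

Lemma bilinE f x y : is_bilin f -> bilin f x y = f x y.
Proof.
move=> [fl fr].
have fE z w : linfun (f z) w = f z w.
  pose h : {linear V -> W} :=
    HB.pack (f z) (GRing.isLinear.Build R V W *:%R (f z) (fr z)).
  exact: (lfunE h).
pose g z := linfun (f z).
have gl : linear g.
  by move=> k z t; apply/lfunP => w; rewrite add_lfunE scale_lfunE !fE fl.
pose gL : {linear U -> 'Hom(V, W)} :=
  HB.pack g (GRing.isLinear.Build R U 'Hom(V, W) *:%R g gl).
by rewrite /bilin (lfunE gL) fE.
Qed.

End Bilinear.

Lemma linfunE (R : realType) (V W : vectType R) (f : V -> W) x :
  linear f -> linfun f x = f x.
Proof.
move=> fl.
pose h : {linear V -> W} := HB.pack f (GRing.isLinear.Build R V W *:%R f fl).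
exact: (lfunE h).
Qed.

Lemma regE (R : realType) (k : R) (x : R^o) : k *: x = k * x :> R.
Proof. by []. Qed.

Section BilinearClosure.
Variables (R : realType) (U V W : vectType R).
Implicit Types f g : U -> V -> W.

Lemma is_bilin_lfun (h : 'Hom(U, 'Hom(V, W))) : is_bilin (fun x y => h x y).
Proof.
by split => z k u v; rewrite linearP //= add_lfunE scale_lfunE.
Qed.

Lemma is_bilin_bilinear (h : {bilinear U -> V -> W}) : is_bilin h.
Proof. by split => z k u v; [apply: linearPl | apply: linearPr]. Qed.

Lemma is_bilinD f g : is_bilin f -> is_bilin g ->
  is_bilin (fun x y => f x y + g x y).
Proof.
by move=> [fl fr] [gl gr]; split=> z k u v;
  rewrite ?fl ?gl ?fr ?gr scalerDr addrACA.
Qed.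

Lemma is_bilinN f : is_bilin f -> is_bilin (fun x y => - f x y).
Proof.
by move=> [fl fr]; split=> z k u v; rewrite ?fl ?fr opprD scalerN.
Qed.

Lemma is_bilin_swap f : is_bilin f -> is_bilin (fun y x => f x y).
Proof. by move=> [fl fr]; split=> z k u v; rewrite ?fl ?fr. Qed.

Lemma is_bilin_pre (U' V' : vectType R) f (h : U' -> U) (h' : V' -> V) :
  linear h -> linear h' -> is_bilin f -> is_bilin (fun x y => f (h x) (h' y)).
Proof.
by move=> hl hl' [fl fr]; split=> z k u v; rewrite ?hl ?hl' ?fl ?fr.
Qed.

Lemma is_bilin_post (W' : vectType R) f (h : 'Hom(W, W')) :
  is_bilin f -> is_bilin (fun x y => h (f x y)).
Proof.
by move=> [fl fr]; split=> z k u v; rewrite ?fl ?fr linearP.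
Qed.

End BilinearClosure.

Record lieAlg (R : realType) := LieAlg {
  lie_vect :> vectType R;
  lie_br : {bilinear lie_vect -> lie_vect -> lie_vect};
  lie_brxx : forall x, lie_br x x = 0;
  lie_jacobi : forall x y z,
    lie_br x (lie_br y z) + lie_br y (lie_br z x) + lie_br z (lie_br x y) = 0
}.

Reserved Notation "{[ x , y ]}" (at level 0, format "{[ x ,  y ]}").
Notation "{[ x , y ]}" := (lie_br _ x y) : ring_scope.

Section LieAlgebra.
Variables (R : realType).
Implicit Types g h : lieAlg R.

Lemma is_bilin_lie g : is_bilin (lie_br g).
Proof. exact: is_bilin_bilinear. Qed.

Lemma lie_brC g (x y : g) : {[x, y]} = - {[y, x]}.
Proof.
apply/eqP; rewrite -addr_eq0; apply/eqP.
have := lie_brxx (x + y).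
by rewrite linearDl !linearDr /= !lie_brxx addr0 add0r.
Qed.

Definition lie_ad g : 'Hom(g, 'End(g)) := bilin (lie_br g).

Lemma lie_adE g (x y : g) : lie_ad g x y = {[x, y]}.
Proof. exact/bilinE/is_bilin_lie. Qed.

Definition lie_abelian g := forall x y : g, {[x, y]} = 0.

Definition lie_center g : {vspace g} := lker (lie_ad g).

Lemma lie_centerP g (x : g) :
  reflect (forall y, {[x, y]} = 0) (x \in lie_center g).
Proof.
rewrite memv_ker; apply: (iffP eqP) => [x0 y|x0].
  by rewrite -lie_adE x0 zero_lfunE.
by apply/lfunP => y; rewrite lie_adE x0 zero_lfunE.
Qed.

Definition lie_hom g h (f : 'Hom(g, h)) :=
  forall x y : g, f {[x, y]} = {[f x, f y]}.

Record lie_ideal g := LieIdeal {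
  ideal_vs :> {vspace g};
  ideal_br : forall x y : g, y \in ideal_vs -> {[x, y]} \in ideal_vs
}.

Section LieQuotient.
Variables (g : lieAlg R) (j : lie_ideal g).

Definition lquot_br (p q : vquot j) : vquot j :=
  \pi_(vquot j) {[repr p, repr q]}.

Lemma lquot_brE x y :
  lquot_br (\pi_(vquot j) x) (\pi_(vquot j) y) = \pi_(vquot j) {[x, y]}.
Proof.
apply/eqP; rewrite /lquot_br vquot_eqE.
set x' := repr _; set y' := repr _.
have -> : {[x', y']} - {[x, y]} = {[x', y' - y]} - {[y, x' - x]}.
  rewrite !linearBr (lie_brC y x') (lie_brC y x) !opprK.
  by rewrite [- (- _ + _)]opprD opprK addrA subrK.
by rewrite rpredB//; apply: ideal_br; apply: vquot_repr.
Qed.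

Fact lquot_br_bilinear : bilinear_for *:%R *:%R lquot_br.
Proof.
split => [r|r] k p q; rewrite -[r]reprK -[p]reprK -[q]reprK /=.
  by rewrite -linearP !lquot_brE linearPl linearP.
by rewrite -linearP !lquot_brE linearPr linearP.
Qed.
HB.instance Definition _ := bilinear_isBilinear.Build R _ _ _ _ _ lquot_br
  lquot_br_bilinear.

Fact lquot_brxx p : lquot_br p p = 0.
Proof. by rewrite -[p]reprK lquot_brE lie_brxx linear0. Qed.

Fact lquot_jacobi p q r :
  lquot_br p (lquot_br q r) + lquot_br q (lquot_br r p)
    + lquot_br r (lquot_br p q) = 0.
Proof.
rewrite -[p]reprK -[q]reprK -[r]reprK.
move: (repr p) (repr q) (repr r) => x y z.
rewrite (lquot_brE x y) (lquot_brE y z) (lquot_brE z x).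
rewrite (lquot_brE x) (lquot_brE y) (lquot_brE z) -!vquot_projE.
by rewrite -!linearD lie_jacobi linear0.
Qed.

Definition lie_quot : lieAlg R := LieAlg lquot_brxx lquot_jacobi.

Definition lie_proj : 'Hom(g, lie_quot) := vquot_proj j.

Lemma lie_proj_hom : lie_hom lie_proj.
Proof. by move=> x y; rewrite !vquot_projE /= lquot_brE. Qed.

End LieQuotient.
End LieAlgebra.

Record sympLie (R : realType) := SympLie {
  symp_lie :> lieAlg R;
  omega : {skew_symmetric symp_lie};
  omega_nondeg : nondegenerate omega;
  omega_closed : forall x y z : symp_lie,
    omega {[x, y]} z + omega {[y, z]} x + omega {[z, x]} y = 0
}.
Arguments omega {R s}.

Definition perp (R : realType) (g : sympLie R) (U : {vspace g}) : {vspace g} :=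
  orthov (omega (s := g)) U.

Definition symp_iso (R : realType) (g h : sympLie R) (f : 'Hom(g, h)) :=
  [/\ bijective f, lie_hom f & forall x y, omega (f x) (f y) = omega x y].

Section QuadraticExtension.
Variables (R : realType) (l : lieAlg R) (a : sympLie R).

(* (qe_g, qe_j, qe_i, qe_p) is the data; the short exact sequence is         *)
(* qe_i_inj, qe_exact and qe_p_surj. Since qe_i is an injective morphism with *)
(* image perp j / j, qe_i_omega makes it a symplectic isomorphism onto it.    *)
Record quadExt := QuadExt {
  qe_g : sympLie R;
  qe_j : lie_ideal qe_g;
  qe_jz : (qe_j <= lie_center qe_g)%VS;
  qe_j_isotropic : (qe_j <= perp qe_j)%VS;
  qe_i : 'Hom(a, lie_quot qe_j);
  qe_p : 'Hom(lie_quot qe_j, l);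
  qe_i_hom : lie_hom qe_i;
  qe_p_hom : lie_hom qe_p;
  qe_i_inj : injective qe_i;
  qe_exact : limg qe_i = lker qe_p;
  qe_p_surj : limg qe_p = fullv;
  qe_im_i : limg qe_i = (lie_proj qe_j @: perp qe_j)%VS;
  (* The form induced on perp j / j is computed on representatives. *)
  qe_i_omega : forall (A1 A2 : a) (X1 X2 : qe_g),
    X1 \in perp qe_j -> X2 \in perp qe_j ->
    qe_i A1 = lie_proj qe_j X1 -> qe_i A2 = lie_proj qe_j X2 ->
    omega A1 A2 = omega X1 X2
}.

Definition balanced (E : quadExt) :=
  qe_j E = (lie_center (qe_g E) :&: perp (lie_center (qe_g E)))%VS
    :> {vspace _}.

Definition qe_equiv (E1 E2 : quadExt) :=
  exists Phi : 'Hom(qe_g E1, qe_g E2),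
    [/\ symp_iso Phi, (Phi @: qe_j E1)%VS = qe_j E2 &
      let Phibar : 'Hom(lie_quot (qe_j E1), lie_quot (qe_j E2)) :=
        vquot_desc (qe_j E1) (lie_proj (qe_j E2) \o Phi)%VF in
      (Phibar \o qe_i E1)%VF = qe_i E2 /\ (qe_p E2 \o Phibar)%VF = qe_p E1].

(* Sets of extensions and of cochains are plain predicates: the record        *)
(* quadExt contains a vectType, which makes it too large (for the universe    *)
(* constraints of the library) to be the argument of "set" or of "set_bij".   *)
Definition qe_class (E : quadExt) : quadExt -> Prop := qe_equiv E.

Definition qe_classes (D : quadExt -> Prop) := exists E, D = qe_class E.

Definition balanced_classes (D : quadExt -> Prop) :=
  exists E, balanced E /\ D = qe_class E.

Local Notation dual := 'Hom(l, R^o).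

(* gam c L1 A L2 is gamma(L1, A, L2). That eps is alternating is part of Z2.  *)
Record cochain := Cochain {
  gam : 'Hom(l, 'Hom(a, dual));
  eps : 'Hom(l, 'Hom(l, dual));
  xi : 'Hom(l, 'End(a))
}.

(* The isomorphism from a to its dual given by omega. *)
Definition flat : 'Hom(a, 'Hom(a, R^o)) :=
  bilin (fun x y : a => omega x y : R^o).

Lemma is_bilin_omega : is_bilin (fun x y : a => omega x y : R^o).
Proof. by split => z k u v; [apply: linearPl | apply: linearPr]. Qed.

Lemma flatE x y : flat x y = omega x y.
Proof. exact/bilinE/is_bilin_omega. Qed.

Lemma flat_inj : lker flat == 0%VS.
Proof.
apply/lker0P => x y /eqP; rewrite -subr_eq0 -linearB => /eqP xy.
have /eqP nd : orthov (omega (s := a)) fullv == 0%VS := omega_nondeg a.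
apply/eqP; rewrite -subr_eq0 -memv0 -nd.
by apply/mem_orthovP => z _; rewrite -flatE xy zero_lfunE.
Qed.

Lemma flatK (f : 'Hom(a, R^o)) : flat ((flat^-1)%VF f) = f.
Proof.
apply: limg_lfunVK; suff -> : limg flat = fullv by apply: memvf.
apply/eqP; rewrite eqEdim subvf limg_dim_eq ?(eqP flat_inj) ?capv0//.
by rewrite !dimvf; apply: eq_leq; apply: muln1.
Qed.

(* alpha L1 L2 is the element of a representing the functional on the right   *)
(* of alphaE.                                                                 *)
Definition alpha (c : cochain) : 'Hom(l, 'Hom(l, a)) :=
  bilin (fun L1 L2 => (flat^-1)%VF
    (linfun (fun A : a => gam c L1 A L2 - gam c L2 A L1))).

Lemma alphaE c L1 L2 A :
  omega (alpha c L1 L2) A = gam c L1 A L2 - gam c L2 A L1.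
Proof.
have fl z t : linear (fun A : a => gam c z A t - gam c t A z).
  move=> k u v; rewrite !linearP /= !(add_lfunE, scale_lfunE) !regE; ring.
rewrite /alpha bilinE.
  by rewrite -flatE flatK linfunE.
split=> z k u v; rewrite -linearP; congr (_ _); apply/lfunP => B;
  rewrite add_lfunE scale_lfunE !linfunE//;
  rewrite !linearP /= !(add_lfunE, scale_lfunE, linearP) /= !regE; ring.
Qed.

Definition beta (c : cochain) : 'Hom(a, 'Hom(a, dual)) :=
  bilin (fun A1 A2 => linfun (fun L =>
    - omega (xi c L A1) A2 - omega A1 (xi c L A2) : R^o)).

Lemma betaE c A1 A2 L :
  beta c A1 A2 L = - omega (xi c L A1) A2 - omega A1 (xi c L A2).
Proof.
have fl B1 B2 : linear (fun L =>
    - omega (xi c L B1) B2 - omega B1 (xi c L B2) : R^o).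
  move=> k u v; rewrite !linearP /= !(add_lfunE, scale_lfunE).
  by rewrite !linearPl !linearPr /= !regE; ring.
rewrite /beta bilinE ?linfunE//.
split=> z k u v; apply/lfunP => B; rewrite add_lfunE scale_lfunE !linfunE//;
  by rewrite !linearP /= ?linearPl ?linearPr /= ?regE; ring.
Qed.

Record Z2 (c : cochain) : Prop := IsZ2 {
  Z2_eps_alt : forall L, eps c L L = 0;
  Z2_der : forall L (A1 A2 : a),
    xi c L {[A1, A2]} = {[xi c L A1, A2]} + {[A1, xi c L A2]};
  Z2_xi_comm : forall L1 L2,
    (xi c L1 \o xi c L2)%VF - (xi c L2 \o xi c L1)%VF
    = lie_ad a (alpha c L1 L2);
  Z2_xi_alpha : forall L1 L2 L3,
    xi c L1 (alpha c L2 L3) + xi c L2 (alpha c L3 L1)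
      + xi c L3 (alpha c L1 L2) = 0;
  Z2_beta : forall L A1 A2,
    beta c (xi c L A1) A2 + beta c A1 (xi c L A2) = gam c L {[A1, A2]};
  Z2_gam_xi : forall L1 L2 A,
    gam c L2 (xi c L1 A) - gam c L1 (xi c L2 A) + beta c (alpha c L1 L2) A = 0;
  Z2_gam_alpha : forall L1 L2 L3,
    gam c L1 (alpha c L2 L3) + gam c L2 (alpha c L3 L1)
      + gam c L3 (alpha c L1 L2) = 0;
  Z2_eps : forall L1 L2 L3,
    eps c L1 L2 L3 + eps c L2 L3 L1 + eps c L3 L1 L2 = 0
}.

Record Z2sharp (c : cochain) : Prop := IsZ2sharp {
  Z2sharp_Z2 : Z2 c;
  Z2sharp_a : forall L, (exists A : a,
      [/\ lie_ad a A + xi c L = 0, gam c L + beta c A = 0,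
          forall L', alpha c L L' = xi c L' A &
          forall L', eps c L L' = gam c L' A]) -> L = 0;
  (* The subspace P of a is non-degenerate for omega. *)
  Z2sharp_b :
    let P (A : a) := [/\ A \in lie_center a, beta c A = 0 &
                         forall L, xi c L A = 0 /\ gam c L A = 0] in
    forall A, P A -> (forall B, P B -> omega A B = 0) -> A = 0
}.

Definition tau_star (tau : 'Hom(l, a)) : 'Hom(a, dual) :=
  bilin (fun A L => omega (tau L) A : R^o).

Lemma tau_starE tau A L : tau_star tau A L = omega (tau L) A.
Proof.
rewrite /tau_star bilinE//; apply: is_bilin_swap.
apply: (@is_bilin_pre _ _ _ _ _ _ _ tau id) is_bilin_omega => //.
exact: linearP.
Qed.

Definition act_gam c tau L A : dual :=
  gam c L A + tau_star tau (xi c L A) - tau_star tau {[tau L, A]}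
    - beta c (tau L) A.

Definition act_eps c tau L1 L2 : dual :=
  eps c L1 L2 + tau_star tau (alpha c L1 L2)
    - gam c L1 (tau L2) + gam c L2 (tau L1)
    - tau_star tau (xi c L1 (tau L2) - xi c L2 (tau L1))
    + tau_star tau {[tau L1, tau L2]} + beta c (tau L1) (tau L2).

Definition act_xi c tau L A : a := xi c L A - {[tau L, A]}.

Definition act (c : cochain) (tau : 'Hom(l, a)) : cochain := {|
  gam := bilin (act_gam c tau);
  eps := bilin (act_eps c tau);
  xi := bilin (act_xi c tau)
|}.

Lemma act_gamE c tau L A : gam (act c tau) L A = act_gam c tau L A.
Proof.
have tauP := linearP tau; have idP : linear (@idfun a) by [].
apply: bilinE.
do 2?[apply: is_bilinD; last apply: is_bilinN]; first apply: is_bilinD.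
- exact: is_bilin_lfun.
- exact: (is_bilin_post (tau_star tau) (is_bilin_lfun (xi c))).
- exact: (is_bilin_post (tau_star tau) (is_bilin_pre tauP idP (is_bilin_lie a))).
- exact: (is_bilin_pre tauP idP (is_bilin_lfun (beta c))).
Qed.

Lemma act_xiE c tau L A : xi (act c tau) L A = act_xi c tau L A.
Proof.
have tauP := linearP tau; have idP : linear (@idfun a) by [].
apply: bilinE; apply: is_bilinD; first exact: is_bilin_lfun.
exact/is_bilinN/(is_bilin_pre tauP idP (is_bilin_lie a)).
Qed.

Lemma act_epsE c tau L1 L2 : eps (act c tau) L1 L2 = act_eps c tau L1 L2.
Proof.
have tauP := linearP tau; have idP : linear (@idfun l) by [].
have bil_pre (h : 'Hom(l, 'Hom(a, dual))) :=
  is_bilin_pre idP tauP (is_bilin_lfun h).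
have bil_xi := is_bilin_pre idP tauP (is_bilin_lfun (xi c)).
apply: bilinE; do 6?[apply: is_bilinD].
- exact: is_bilin_lfun.
- exact: (is_bilin_post (tau_star tau) (is_bilin_lfun (alpha c))).
- exact/is_bilinN/bil_pre.
- exact: (is_bilin_swap (bil_pre (gam c))).
- apply: is_bilinN.
  exact: (is_bilin_post (tau_star tau)
           (is_bilinD bil_xi (is_bilinN (is_bilin_swap bil_xi)))).
- exact: (is_bilin_post (tau_star tau)
           (is_bilin_pre tauP tauP (is_bilin_lie a))).
- exact: (is_bilin_pre tauP tauP (is_bilin_lfun (beta c))).
Qed.

Definition cclass (c : cochain) : cochain -> Prop :=
  fun c' => exists tau, c' = act c tau.

Definition H2 (C : cochain -> Prop) := exists c, Z2 c /\ C = cclass c.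

Definition H2sharp (C : cochain -> Prop) := exists c, Z2sharp c /\ C = cclass c.

End QuadraticExtension.

Lemma omegaC (R : realType) (g : sympLie R) (x y : g) : omega x y = - omega y x.
Proof. by rewrite hermC expr1 mulN1r. Qed.

Section StandardExtension.
Variables (R : realType) (l : lieAlg R) (a : sympLie R).
Hypothesis l_abelian : lie_abelian l.
Variables (c : cochain l a).
Hypothesis cZ : Z2 c.

Local Notation dual := 'Hom(l, R^o).
Local Notation D := (dual * a * l)%type.
Local Notation γ := (gam c).
Local Notation ε := (eps c).
Local Notation ξ := (xi c).
Local Notation α := (alpha c).
Local Notation β := (beta c).

(* x = (Z, A, L) stands for Z + A + L. *)
Definition std_br (x y : D) : D :=
  (β x.1.2 y.1.2 + γ x.2 y.1.2 - γ y.2 x.1.2 + ε x.2 y.2,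
   {[x.1.2, y.1.2]} + ξ x.2 y.1.2 - ξ y.2 x.1.2 + α x.2 y.2,
   0).

Fact std_br_bilinear : bilinear_for *:%R *:%R std_br.
Proof.
have lA : linear (fun x : D => x.1.2) by [].
have lL : linear (fun x : D => x.2) by [].
have bZ : is_bilin (fun x y => (std_br x y).1.1).
  apply: is_bilinD; first apply: is_bilinD; first apply: is_bilinD.
  - exact: (is_bilin_pre lA lA (is_bilin_lfun β)).
  - exact: (is_bilin_pre lL lA (is_bilin_lfun γ)).
  - exact/is_bilinN/is_bilin_swap/(is_bilin_pre lL lA (is_bilin_lfun γ)).
  - exact: (is_bilin_pre lL lL (is_bilin_lfun ε)).
have bA : is_bilin (fun x y => (std_br x y).1.2).
  apply: is_bilinD; first apply: is_bilinD; first apply: is_bilinD.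
  - exact: (is_bilin_pre lA lA (is_bilin_lie a)).
  - exact: (is_bilin_pre lL lA (is_bilin_lfun ξ)).
  - exact/is_bilinN/is_bilin_swap/(is_bilin_pre lL lA (is_bilin_lfun ξ)).
  - exact: (is_bilin_pre lL lL (is_bilin_lfun α)).
have pairE (u v : D) : u.1.1 = v.1.1 -> u.1.2 = v.1.2 -> u.2 = v.2 -> u = v.
  by case: u v => [[? ?] ?] [[? ?] ?] /= -> -> ->.
split=> z k u v; apply: pairE.
- exact: bZ.1.
- exact: bA.1.
- by rewrite /= scaler0 addr0.
- exact: bZ.2.
- exact: bA.2.
- by rewrite /= scaler0 addr0.
Qed.
HB.instance Definition _ := bilinear_isBilinear.Build R _ _ _ _ _ std_br
  std_br_bilinear.

Let betaC A1 A2 : β A1 A2 = - β A2 A1.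
Proof.
apply/lfunP => L; rewrite opp_lfunE !betaE (omegaC A1) (omegaC (ξ L A1)).
by ring.
Qed.

Let alphaxx L : α L L = 0.
Proof.
apply: (lker0P (flat_inj a)); apply/lfunP => A.
by rewrite flatE alphaE linear0 zero_lfunE subrr.
Qed.

Fact std_brxx (x : D) : std_br x x = 0.
Proof.
case: x => [[Z A] L]; rewrite /std_br /= addrK addrK lie_brxx alphaxx addr0.
rewrite Z2_eps_alt// addr0; congr (_, _, _).
by apply/lfunP => L'; rewrite betaE zero_lfunE (omegaC A) opprK addNr.
Qed.

Let beta_jacobi A1 A2 A3 :
  β A1 {[A2, A3]} + β A2 {[A3, A1]} + β A3 {[A1, A2]} = 0.
Proof.
apply/lfunP => L; rewrite !add_lfunE !betaE zero_lfunE !(Z2_der cZ).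
rewrite !linearDr /=.
have e1 := omega_closed (ξ L A1) A2 A3.
have e2 := omega_closed (ξ L A2) A3 A1.
have e3 := omega_closed (ξ L A3) A1 A2.
rewrite !(omegaC {[_, _]}) in e1 e2 e3.
rewrite (lie_brC A3 (ξ L A1)) (lie_brC A1 (ξ L A2)) (lie_brC A2 (ξ L A3)).
rewrite (lie_brC A3 (ξ L A1)) (lie_brC A1 (ξ L A2)) (lie_brC A2 (ξ L A3))
  in e1 e2 e3.
rewrite !linearNr /= in e1 e2 e3 *.
by lra.
Qed.

Let xi_comm L1 L2 A : ξ L1 (ξ L2 A) - ξ L2 (ξ L1 A) = {[α L1 L2, A]}.
Proof.
by rewrite -lie_adE -(Z2_xi_comm cZ) add_lfunE opp_lfunE !comp_lfunE.
Qed.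

Let lin4 (V W : vectType R) (h : 'Hom(V, W)) x y z w :
  h (x + y - z + w) = h x + h y - h z + h w.
Proof. by rewrite linearD linearB linearD. Qed.

Fact std_jacobi (x y z : D) :
  std_br x (std_br y z) + std_br y (std_br z x) + std_br z (std_br x y) = 0.
Proof.
case: x y z => [[Z1 A1] L1] [[Z2 A2] L2] [[Z3 A3] L3].
have -> : 0 = (0, 0, 0) :> D by [].
rewrite /std_br /= !(linear0, zero_lfunE, subr0, addr0).
congr (_, _, _).
  apply: scalar_inj => f; rewrite linear0.
  have e0 := congr1 f (beta_jacobi A1 A2 A3).
  have e1 := congr1 f (Z2_beta cZ L1 A2 A3).
  have e2 := congr1 f (Z2_beta cZ L2 A3 A1).
  have e3 := congr1 f (Z2_beta cZ L3 A1 A2).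
  have e4 := congr1 f (Z2_gam_xi cZ L2 L3 A1).
  have e5 := congr1 f (Z2_gam_xi cZ L3 L1 A2).
  have e6 := congr1 f (Z2_gam_xi cZ L1 L2 A3).
  have e7 := congr1 f (Z2_gam_alpha cZ L1 L2 L3).
  rewrite (betaC (ξ L1 A2)) in e1; rewrite (betaC (ξ L2 A3)) in e2.
  rewrite (betaC (ξ L3 A1)) in e3; rewrite (betaC (α L2 L3)) in e4.
  rewrite (betaC (α L3 L1)) in e5.
  rewrite (betaC (α L1 L2)) in e6.
  have fD x y : f (x + y) = f x + f y by exact: linearD.
  have fN x : f (- x) = - f x by exact: linearN.
  rewrite (lin4 (β A1)) (lin4 (β A2)) (lin4 (β A3)).
  rewrite (lin4 (γ L1)) (lin4 (γ L2)) (lin4 (γ L3)).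
  rewrite !(fD, fN) in e0 e1 e2 e3 e4 e5 e6 e7 *.
  rewrite linear0 in e0 e4 e5 e6 e7.
  by lra.
2: by rewrite /= !addr0.
apply: scalar_inj => f; rewrite linear0 /=.
have e0 := congr1 f (lie_jacobi A1 A2 A3).
have e1 := congr1 f (Z2_der cZ L1 A2 A3).
have e2 := congr1 f (Z2_der cZ L2 A3 A1).
have e3 := congr1 f (Z2_der cZ L3 A1 A2).
have e4 := congr1 f (xi_comm L2 L3 A1).
have e5 := congr1 f (xi_comm L3 L1 A2).
have e6 := congr1 f (xi_comm L1 L2 A3).
have e7 := congr1 f (Z2_xi_alpha cZ L1 L2 L3).
rewrite (lie_brC (ξ L1 A2)) in e1; rewrite (lie_brC (ξ L2 A3)) in e2.
rewrite (lie_brC (ξ L3 A1)) in e3; rewrite (lie_brC (α L2 L3)) in e4.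
rewrite (lie_brC (α L3 L1)) in e5; rewrite (lie_brC (α L1 L2)) in e6.
have fD x y : f (x + y) = f x + f y by exact: linearD.
have fN x : f (- x) = - f x by exact: linearN.
have br4 A x y z w :
    {[A, x + y - z + w]} = {[A, x]} + {[A, y]} - {[A, z]} + {[A, w]} :> a.
  by rewrite -!lie_adE lin4.
rewrite !br4 (lin4 (ξ L1)) (lin4 (ξ L2)) (lin4 (ξ L3)).
rewrite !(fD, fN) in e0 e1 e2 e3 e4 e5 e6 e7 *.
rewrite linear0 in e0 e7.
by lra.
Qed.

Definition std_lie : lieAlg R := LieAlg std_brxx std_jacobi.

Definition std_omega (x y : std_lie) : R :=
  x.1.1 y.2 + omega x.1.2 y.1.2 - y.1.1 x.2.

Fact std_omega_bilinear :
  bilinear_for *%R (idfun \; *%R) std_omega.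
Proof.
split=> z k u v; rewrite /std_omega /=.
  rewrite add_lfunE scale_lfunE linearPl linearP /= !regE; ring.
rewrite add_lfunE scale_lfunE linearPr linearP /= !regE; ring.
Qed.
HB.instance Definition _ := bilinear_isBilinear.Build R _ _ _ _ _ std_omega
  std_omega_bilinear.

Fact std_omega_skew x y :
  std_omega x y = (-1) ^+ true * idfun (std_omega y x).
Proof. by rewrite /std_omega (omegaC x.1.2) /=; ring. Qed.
HB.instance Definition _ := isHermitianSesquilinear.Build R _ true idfun
  std_omega
  std_omega_skew.

Fact std_omega_nondeg : nondegenerate (std_omega : {skew_symmetric std_lie}).
Proof.
rewrite /nondegenerate -subv0; apply/subvP => -[[Z A] L] /mem_orthovP x0.
have xE (Z' : dual) A' L' : Z L' + omega A A' - Z' L = 0.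
  exact: (x0 ((Z', A', L') : std_lie) (memvf _)).
rewrite memv0; apply/eqP; congr (_, _, _).
- apply/lfunP => L'; have := xE 0 0 L'.
  by rewrite linear0r !zero_lfunE subr0 addr0.
- apply: (lker0P (flat_inj a)); apply/lfunP => A'; have := xE 0 A' 0.
  by rewrite linear0 zero_lfunE subr0 add0r flatE linear0 zero_lfunE.
- apply: scalar_inj => f; have := xE (linfun (f : l -> R^o)) 0 0.
  rewrite !linear0 lfunE /= add0r.
  by rewrite sub0r => /eqP; rewrite oppr_eq0 => /eqP ->.
Qed.

Fact std_omega_closed (x y z : std_lie) :
  std_omega {[x, y]} z + std_omega {[y, z]} x + std_omega {[z, x]} y = 0.
Proof.
case: x y z => [[Z1 A1] L1] [[Z2 A2] L2] [[Z3 A3] L3].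
rewrite /std_omega /= !(linear0, subr0).
have e0 := omega_closed A1 A2 A3.
have e1 := Z2_eps cZ L1 L2 L3.
rewrite !(add_lfunE, opp_lfunE) !betaE.
have dD (x y z w u : a) :
    omega (x + y - z + w) u = omega x u + omega y u - omega z u + omega w u.
  by rewrite linearDl linearBl linearDl.
rewrite !dD !alphaE.
rewrite (omegaC A1 (ξ L3 A2)) (omegaC A2 (ξ L1 A3)) (omegaC A3 (ξ L2 A1)).
by lra.
Qed.

Definition std_symp : sympLie R := SympLie std_omega_nondeg std_omega_closed.

Let std_inZ : 'Hom(dual, std_symp) := linfun (fun Z => (Z, 0, 0) : std_symp).
Let std_inA : 'Hom(a, std_symp) := linfun (fun A => (0, A, 0) : std_symp).
Let std_prL : 'Hom(std_symp, l) := linfun (fun x : std_symp => x.2).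

Let std_inZE Z : std_inZ Z = (Z, 0, 0).
Proof.
apply: linfunE => k u v; congr (_, _, _); rewrite /= scaler0 addr0//.
Qed.

Let std_inAE A : std_inA A = (0, A, 0).
Proof.
by apply: linfunE => k u v; congr (_, _, _); rewrite /= scaler0 addr0.
Qed.

Let std_prLE x : std_prL x = x.2.
Proof. exact: linfunE. Qed.

Let mem_stdZ (x : std_symp) :
  (x \in limg std_inZ) = (x.1.2 == 0) && (x.2 == 0).
Proof.
apply/memv_imgP/andP => [[Z _ ->]|[/eqP x2 /eqP x3]]; first by rewrite std_inZE.
exists x.1.1; first exact: memvf.
by rewrite std_inZE; case: x x2 x3 => [[? ?] ?] /= -> ->.
Qed.

Fact std_ideal_br (x y : std_symp) :
  y \in limg std_inZ -> {[x, y]} \in limg std_inZ.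
Proof.
rewrite !mem_stdZ => /andP[/eqP y2 /eqP y3] /=.
by rewrite y2 y3 !linear0 zero_lfunE subr0 !addr0 !eqxx.
Qed.

Definition std_ideal : lie_ideal std_symp := LieIdeal std_ideal_br.

Definition std_i : 'Hom(a, lie_quot std_ideal) :=
  (lie_proj std_ideal \o std_inA)%VF.

Definition std_p : 'Hom(lie_quot std_ideal, l) := vquot_desc std_ideal std_prL.

Let mem_perp (x : std_symp) : (x \in perp std_ideal) = (x.2 == 0).
Proof.
apply/mem_orthovP/eqP => [h|x0 y].
  apply: scalar_inj => f.
  have /h : std_inZ (linfun (f : l -> R^o)) \in limg std_inZ.
    by rewrite memv_img ?memvf.
  rewrite std_inZE /= /std_omega /= !linear0 lfunE /= add0r sub0r.
  by move/eqP; rewrite oppr_eq0 => /eqP ->.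
rewrite mem_stdZ => /andP[/eqP y2 /eqP y3].
by rewrite /= /std_omega x0 y2 y3 !linear0 !addr0.
Qed.

Let std_projE (x y : std_symp) :
  (lie_proj std_ideal x == lie_proj std_ideal y) =
  (x.1.2 == y.1.2) && (x.2 == y.2).
Proof.
by rewrite !vquot_projE vquot_eqE mem_stdZ /= !subr_eq0.
Qed.

Let std_iE A : std_i A = lie_proj std_ideal (0, A, 0).
Proof. by rewrite comp_lfunE std_inAE. Qed.

Let std_pE x : std_p (lie_proj std_ideal x) = x.2.
Proof.
rewrite vquot_descE ?std_prLE//; apply/subvP => y.
by rewrite mem_stdZ memv_ker std_prLE => /andP[].
Qed.

Let std_projP (q : lie_quot std_ideal) : exists x, q = lie_proj std_ideal x.
Proof. by exists (repr q); rewrite vquot_projE reprK. Qed.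

Fact std_jz : (std_ideal <= lie_center std_symp)%VS.
Proof.
apply/subvP => x; rewrite mem_stdZ => /andP[/eqP x2 /eqP x3].
apply/lie_centerP => y; rewrite /= /std_br x2 x3.
by rewrite !linear0 linear0l !zero_lfunE !(subr0, addr0).
Qed.

Fact std_j_isotropic : (std_ideal <= perp std_ideal)%VS.
Proof. by apply/subvP => x; rewrite mem_perp mem_stdZ => /andP[]. Qed.

Fact std_i_hom : lie_hom std_i.
Proof.
move=> A1 A2; rewrite !std_iE -lie_proj_hom; apply/eqP; rewrite std_projE /=.
by rewrite !linear0 !zero_lfunE !(subr0, addr0) !eqxx.
Qed.

Fact std_p_hom : lie_hom std_p.
Proof.
move=> q r; have [x ->] := std_projP q; have [y ->] := std_projP r.
by rewrite -lie_proj_hom !std_pE /= l_abelian.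
Qed.

Fact std_i_inj : injective std_i.
Proof.
by move=> A B /eqP; rewrite !std_iE std_projE /= => /andP[/eqP].
Qed.

Let mem_im_i q : (q \in limg std_i) = (std_p q == 0).
Proof.
apply/memv_imgP/eqP => [[A _ ->]|]; first by rewrite std_iE std_pE.
have [x ->] := std_projP q; rewrite std_pE => x0.
exists x.1.2; first exact: memvf.
by apply/eqP; rewrite std_iE std_projE /= eqxx x0 /=.
Qed.

Fact std_exact : limg std_i = lker std_p.
Proof. by apply/vspaceP => q; rewrite mem_im_i memv_ker. Qed.

Fact std_p_surj : limg std_p = fullv.
Proof.
apply/vspaceP => L; rewrite memvf; apply/memv_imgP.
by exists (lie_proj std_ideal (0, 0, L)); [apply: memvf | rewrite std_pE].
Qed.

Fact std_im_i : limg std_i = (lie_proj std_ideal @: perp std_ideal)%VS.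
Proof.
apply/vspaceP => q; rewrite mem_im_i; apply/eqP/memv_imgP.
  have [x ->] := std_projP q; rewrite std_pE => x0.
  by exists x; rewrite // mem_perp x0.
by move=> [x]; rewrite mem_perp => /eqP x0 ->; rewrite std_pE.
Qed.

Fact std_i_omega (A1 A2 : a) (x1 x2 : std_symp) :
  x1 \in perp std_ideal -> x2 \in perp std_ideal ->
  std_i A1 = lie_proj std_ideal x1 -> std_i A2 = lie_proj std_ideal x2 ->
  omega A1 A2 = omega x1 x2.
Proof.
rewrite !mem_perp => /eqP x10 /eqP x20 /eqP + /eqP.
rewrite !std_iE !std_projE /= => /andP[/eqP -> _] /andP[/eqP -> _].
by rewrite /std_omega x10 x20 !linear0 addr0 add0r.
Qed.

Definition std_ext : quadExt l a :=
  QuadExt std_jz std_j_isotropic std_i_hom std_p_hom std_i_inj std_exact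
    std_p_surj std_im_i std_i_omega.

End StandardExtension.

Definition bij_onto (X Y : Type) (A : X -> Prop) (B : Y -> Prop) (F : X -> Y) :=
  [/\ forall x, A x -> B (F x),
      forall x x', A x -> A x' -> F x = F x' -> x = x' &
      forall y, B y -> exists2 x, A x & F x = y].

(* Main.v *)
Require Import Defs.
From mathcomp Require Import all_boot all_order all_algebra.
From mathcomp Require Import sesquilinear generic_quotient reals boolp.
From mathcomp Require Import ring lra.

Set Implicit Arguments.
Unset Strict Implicit.
Unset Printing Implicit Defensive.

Import Order.TTheory GRing.Theory Num.Theory.

Local Open Scope ring_scope.

(** Write q : g -> l for p composed with the projection g -> g/j.  Call a
    frame of an extension a pair of lifts t : a -> g of i and s : l -> g of q
    with s(l) isotropic and orthogonal to t(a).  Arbitrary lifts are corrected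
    to a frame by elements of j, which omega identifies with the dual of l.  A
    frame identifies g with l^* + a + l, and the numbers omega([s, t], s),
    omega([s, s], s), omega([s, t], t) form a cochain c; closedness of omega
    forces the alpha and beta components of the bracket, so g is d_c, and the
    Jacobi identity of g gives the cocycle conditions.  A frame of d_c itself
    has s(L) = (Z, - tau L, L) and its cochain is c acted on by tau.  Since
    equivalences transport frames, d_c and d_c' are equivalent if and only if
    c' = c tau; the group laws of the action are thus never needed.  Finally,
    condition (a) says that the center of d_c lies in l^* + a, i.e. that l^* is
    orthogonal to the center, and then condition (b) says that the center
    meets its complement in l^* only. *)

(** * Linear algebra of a symplectic form and of the quotient by an ideal *)

Section Symplectic.
Variables (R : realType) (g : sympLie R).
Implicit Types (x y : g) (U : {vspace g}).

Lemma omega_inj x y : (forall z, omega x z = omega y z) -> x = y.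
Proof.
move=> xy; apply: (lker0P (flat_inj g)); apply/lfunP => z.
by rewrite !flatE xy.
Qed.

Lemma omegaDl x y z : omega (x + y) z = omega x z + omega y z.
Proof. exact: linearDl. Qed.

Lemma omegaDr x y z : omega z (x + y) = omega z x + omega z y.
Proof. exact: linearDr. Qed.

Lemma omegaNl x y : omega (- x) y = - omega x y.
Proof. exact: linearNl. Qed.

Lemma omegaNr x y : omega x (- y) = - omega x y.
Proof. exact: linearNr. Qed.

Lemma omega0l x : omega 0 x = 0.
Proof. exact: linear0l. Qed.

Lemma omega0r x : omega x 0 = 0.
Proof. exact: linear0r. Qed.

(** A functional vanishing on U is [omega v] for some v in [perp U], so it kills the double
    complement too. Composing arbitrary functionals with 1 - [projv U] yields x = [projv U x]. *)
Lemma perp_perp_sub U : (perp (perp U) <= U)%VS.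
Proof.
apply/subvP => x /mem_orthovP xU.
suff -> : x = projv U x by apply: memv_proj.
apply: scalar_inj => f; apply/eqP; rewrite -subr_eq0 -linearB; apply/eqP.
pose h : 'Hom(g, R^o) := linfun (fun z => f (z - projv U z) : R^o).
have hE z : h z = f (z - projv U z).
  apply: linfunE => k v w.
  by rewrite -[RHS]linearP scalerBr addrACA -opprD -linearP.
rewrite -hE -[h]flatK flatE omegaC xU ?oppr0//.
apply/mem_orthovP => z zU; rewrite -flatE flatK hE projv_id//.
by rewrite subrr linear0.
Qed.

End Symplectic.

Section Quotient.
Variables (R : realType) (g : lieAlg R) (j : lie_ideal g).

Lemma lie_projP (y : lie_quot j) : exists x, y = lie_proj j x.
Proof. by exists (repr y); rewrite vquot_projE reprK. Qed.

Lemma lie_proj_eq0 x : (lie_proj j x == 0) = (x \in j).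
Proof.
by have := vquot_eqE j x 0; rewrite -!vquot_projE linear0 subr0.
Qed.

End Quotient.

(** * Frames of a quadratic extension and their cochains *)

Section Frames.
Variables (R : realType) (l : lieAlg R) (a : sympLie R).
Hypothesis l_abelian : lie_abelian l.
Local Notation dual := 'Hom(l, R^o).
Local Notation D := (dual * a * l)%type.

Section Extension.
Variable (E : quadExt l a).
Local Notation g := (qe_g E).
Local Notation j := (qe_j E).

Definition qe_q : 'Hom(g, l) := (qe_p E \o lie_proj j)%VF.

Lemma qe_qE x : qe_q x = qe_p E (lie_proj j x).
Proof. exact: comp_lfunE. Qed.

(** By exactness, ker [qe_q] is the preimage of perp j / j, and this is [perp j] because j is
    isotropic. *)
Lemma qe_q_perp x : (x \in perp j) = (qe_q x == 0).
Proof.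
rewrite qe_qE -memv_ker -qe_exact qe_im_i.
apply/idP/memv_imgP => [xj|[y yj xy]].
  by exists x.
rewrite -[x](subrK y) rpredD// (subvP (qe_j_isotropic E))//.
by rewrite -lie_proj_eq0 linearB /= xy subrr.
Qed.

Lemma qe_q_br x y : qe_q {[x, y]} = 0.
Proof. by rewrite qe_qE lie_proj_hom qe_p_hom l_abelian. Qed.

Lemma qe_j_br x y : x \in j -> {[x, y]} = 0.
Proof. by move=> /(subvP (qe_jz E)) /lie_centerP. Qed.

Lemma qe_i_q A x : lie_proj j x = qe_i E A -> qe_q x = 0.
Proof.
by move=> xA; apply/eqP; rewrite qe_qE xA -memv_ker -qe_exact memv_img ?memvf.
Qed.

(* Inverse of the isomorphism from j to the dual of l induced by omega. *)
Definition qe_u : 'Hom(dual, g) :=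
  linfun (fun f : dual => ((flat g)^-1)%VF (f \o qe_q)%VF).

Lemma qe_uE f x : omega (qe_u f) x = f (qe_q x).
Proof.
have -> : qe_u f = ((flat g)^-1)%VF (f \o qe_q)%VF.
  apply: linfunE => k u v; rewrite -linearP; congr (_ _); apply/lfunP => y.
  by rewrite !(add_lfunE, scale_lfunE, comp_lfunE).
by rewrite -flatE flatK comp_lfunE.
Qed.

(** [qe_u f] is orthogonal to ker [qe_q], which is [perp j]; the double complement of j lies in
    j. *)
Lemma qe_u_j f : qe_u f \in j.
Proof.
apply/(subvP (perp_perp_sub j))/mem_orthovP => x.
by rewrite qe_q_perp qe_uE => /eqP->; rewrite linear0.
Qed.

Record frame (t : 'Hom(a, g)) (s : 'Hom(l, g)) : Prop := IsFrame {
  frame_t : forall A, lie_proj j (t A) = qe_i E A;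
  frame_s : forall L, qe_q (s L) = L;
  frame_ts : forall A L, omega (t A) (s L) = 0;
  frame_ss : forall L L', omega (s L) (s L') = 0
}.

Lemma ex_frame : exists t s, frame t s.
Proof.
have [t0 t0E] : exists t0 : 'Hom(a, g), forall A, lie_proj j (t0 A) = qe_i E A.
  exists ((lie_proj j)^-1 \o qe_i E)%VF => A; rewrite comp_lfunE limg_lfunVK//.
  by have [x ->] := lie_projP (qe_i E A); rewrite memv_img ?memvf.
have [s0 s0E] : exists s0 : 'Hom(l, g), forall L, qe_q (s0 L) = L.
  exists (qe_q^-1)%VF => L; apply: limg_lfunVK.
  have : L \in limg (qe_p E) by rewrite qe_p_surj memvf.
  move=> /memv_imgP[y _ ->]; have [x ->] := lie_projP y.
  by rewrite -qe_qE memv_img ?memvf.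
(* [hs] is skew and enters [omega (s L) (s L')] once from each argument, hence the 1/2. In
   [omega (t A) (s L)] only the correction of [t0] counts, as q kills [t0 A], so [ht] has no such
   factor. *)
pose hs := bilin (fun L L' => - (omega (s0 L) (s0 L') / 2) : R^o).
have hsE L L' : hs L L' = - (omega (s0 L) (s0 L') / 2).
  apply: bilinE; split=> z k u v.
    by rewrite linearP linearPl /= !regE; ring.
  by rewrite linearP linearPr /= !regE; ring.
pose ht := bilin (fun A L => - omega (t0 A) (s0 L) : R^o).
have htE A L : ht A L = - omega (t0 A) (s0 L).
  apply: bilinE; split=> z k u v.
    by rewrite linearP linearPl /= !regE; ring.
  by rewrite linearP linearPr /= !regE; ring.
pose t := t0 + (qe_u \o ht)%VF; pose s := s0 + (qe_u \o hs)%VF.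
have tE A : t A = t0 A + qe_u (ht A) by rewrite add_lfunE comp_lfunE.
have sE L : s L = s0 L + qe_u (hs L) by rewrite add_lfunE comp_lfunE.
have qu f : qe_q (qe_u f) = 0.
  by apply/eqP; rewrite -qe_q_perp (subvP (qe_j_isotropic E))// qe_u_j.
have qt A : qe_q (t0 A) = 0 by apply: qe_i_q (t0E A).
exists t, s; split=> [A|L|A L|L L'].
- rewrite tE linearD /= t0E.
  by move: (qe_u_j (ht A)); rewrite -lie_proj_eq0 => /eqP->; rewrite addr0.
- by rewrite sE linearD /= s0E qu addr0.
- rewrite tE sE !(omegaDl, omegaDr) (omegaC (t0 A) (qe_u _)) !qe_uE.
  by rewrite qt qu s0E htE !linear0; ring.
- rewrite !sE !(omegaDl, omegaDr) (omegaC (s0 L) (qe_u _)) !qe_uE.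
  by rewrite qu !s0E !hsE linear0 (omegaC (s0 L') (s0 L)); field.
Qed.

Record frame_cochain (t : 'Hom(a, g)) (s : 'Hom(l, g)) (c : cochain l a)
  : Prop := IsFrameCochain {
  fc_gam : forall L A L', gam c L A L' = omega {[s L, t A]} (s L');
  fc_eps : forall L1 L2 L3, eps c L1 L2 L3 = omega {[s L1, s L2]} (s L3);
  fc_xi : forall L A A', omega (xi c L A) A' = omega {[s L, t A]} (t A')
}.

Section FrameTheory.
Variables (t : 'Hom(a, g)) (s : 'Hom(l, g)).
Hypothesis ts : frame t s.

Lemma ex_frame_cochain : exists c, frame_cochain t s c.
Proof.
have flat_br (W : vectType R) (h : 'Hom(W, g)) :
    is_bilin (fun x y : g => (flat g {[x, y]} \o h)%VF).
  by split=> z k u v; apply/lfunP => w;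
    rewrite !(add_lfunE, scale_lfunE, comp_lfunE, flatE) ?linearPl ?linearPr
      /= ?linearPl.
have tP := linearP t; have sP := linearP s.
exists {| gam := bilin (fun L A => (flat g {[s L, t A]} \o s)%VF);
          eps := bilin (fun L L' => (flat g {[s L, s L']} \o s)%VF);
          xi := bilin (fun L A =>
                  ((flat a)^-1)%VF (flat g {[s L, t A]} \o t)%VF) |}.
split=> [L A L'|L1 L2 L3|L A A'] /=.
- rewrite bilinE ?comp_lfunE ?flatE//.
  exact: (is_bilin_pre sP tP (flat_br _ s)).
- rewrite bilinE ?comp_lfunE ?flatE//.
  exact: (is_bilin_pre sP sP (flat_br _ s)).
- rewrite -[LHS]flatE bilinE ?flatK ?comp_lfunE ?flatE//.
  exact: (is_bilin_post ((flat a)^-1)%VF (is_bilin_pre sP tP (flat_br _ t))).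
Qed.

Lemma frame_qt A : qe_q (t A) = 0.
Proof. exact: qe_i_q (frame_t ts A). Qed.

Lemma qe_q_u f : qe_q (qe_u f) = 0.
Proof.
by apply/eqP; rewrite -qe_q_perp (subvP (qe_j_isotropic E))// qe_u_j.
Qed.

Lemma frame_ut f A : omega (qe_u f) (t A) = 0.
Proof. by rewrite qe_uE frame_qt linear0. Qed.

Lemma frame_us f L : omega (qe_u f) (s L) = f L.
Proof. by rewrite qe_uE (frame_s ts). Qed.

Lemma frame_tt A A' : omega (t A) (t A') = omega A A'.
Proof.
apply/esym/(@qe_i_omega _ _ _ E); rewrite ?qe_q_perp ?frame_qt//.
  by rewrite (frame_t ts).
by rewrite (frame_t ts).
Qed.

(** Modulo j, x - s(q x) lies in im i, which supplies A; the remainder is in j, hence some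
    [qe_u f]. *)
Lemma frame_decomp x : exists f A, x = qe_u f + t A + s (qe_q x).
Proof.
have /memv_imgP[A _ Ax] : lie_proj j (x - s (qe_q x)) \in limg (qe_i E).
  by rewrite qe_exact memv_ker -qe_qE linearB /= (frame_s ts) subrr.
pose z := x - s (qe_q x) - t A.
have zj : z \in j.
  by rewrite -lie_proj_eq0 /z linearB /= Ax (frame_t ts) subrr.
(* [frame_us] forces f L = omega(z, s L). This f represents z against every y because y - s(q y)
   lies in [perp j]. *)
exists (flat g z \o s)%VF, A; suff <- : z = qe_u (flat g z \o s)%VF.
  by rewrite /z !subrK.
apply: omega_inj => y; rewrite qe_uE comp_lfunE flatE.
have yj : y - s (qe_q y) \in perp j.
  by rewrite qe_q_perp linearB /= (frame_s ts) subrr.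
have /mem_orthovP/(_ _ zj) := yj.
by rewrite omegaDl omegaNl (omegaC y) (omegaC (s _)); lra.
Qed.

(** By [frame_decomp] it is enough to pair with j, t(a) and s(l), and pairing with [qe_u f] sees
    only [qe_q]. *)
Lemma frame_eq x y : qe_q x = qe_q y ->
  (forall A, omega x (t A) = omega y (t A)) ->
  (forall L, omega x (s L) = omega y (s L)) -> x = y.
Proof.
move=> xyq xyt xys; apply: omega_inj => z.
have [f [A ->]] := frame_decomp z.
by rewrite !omegaDr (omegaC x) (omegaC y) !qe_uE xyq xyt xys.
Qed.

Variable c : cochain l a.
Hypothesis tsc : frame_cochain t s c.

Lemma frame_br_st L A : {[s L, t A]} = qe_u (gam c L A) + t (xi c L A).
Proof.
apply: frame_eq => [|A'|L'].
- by rewrite qe_q_br linearD /= qe_q_u frame_qt addr0.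
- by rewrite omegaDl frame_ut add0r frame_tt (fc_xi tsc).
- by rewrite omegaDl frame_us (frame_ts ts) addr0 (fc_gam tsc).
Qed.

(** Closedness of omega on s L1, s L2, t A expresses the a-component through gamma, by the very
    formula that defines [alpha]. *)
Lemma frame_br_ss L1 L2 :
  {[s L1, s L2]} = qe_u (eps c L1 L2) + t (alpha c L1 L2).
Proof.
apply: frame_eq => [|A|L].
- by rewrite qe_q_br linearD /= qe_q_u frame_qt addr0.
- rewrite omegaDl frame_ut add0r frame_tt alphaE !(fc_gam tsc).
  have := omega_closed (s L1) (s L2) (t A).
  by rewrite (lie_brC (t A) (s L1)) omegaNl; lra.
- by rewrite omegaDl frame_us (frame_ts ts) addr0 (fc_eps tsc).
Qed.

(** The a-component comes from i being a homomorphism of symplectic Lie algebras, the other one from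
    closedness of omega on t A1, t A2, s L. *)
Lemma frame_br_tt A1 A2 :
  {[t A1, t A2]} = qe_u (beta c A1 A2) + t {[A1, A2]}.
Proof.
apply: frame_eq => [|A|L].
- by rewrite qe_q_br linearD /= qe_q_u frame_qt addr0.
- rewrite omegaDl frame_ut add0r frame_tt.
  apply/esym/(@qe_i_omega _ _ _ E); rewrite ?qe_q_perp ?qe_q_br ?frame_qt//.
    by rewrite lie_proj_hom !(frame_t ts) qe_i_hom.
  by rewrite (frame_t ts).
- rewrite omegaDl frame_us (frame_ts ts) addr0 betaE (fc_xi tsc).
  rewrite (omegaC A1) (fc_xi tsc).
  have := omega_closed (t A1) (t A2) (s L).
  by rewrite (lie_brC (t A2) (s L)) omegaNl; lra.
Qed.

Definition frame_map (x : D) : g := qe_u x.1.1 + t x.1.2 + s x.2.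

Lemma frame_map_linear : linear frame_map.
Proof.
move=> k x y; rewrite /frame_map /= !linearP /= !scalerDr.
by rewrite (addrACA (k *: qe_u _)) [LHS]addrACA.
Qed.

Lemma frame_map_br x y :
  frame_map (std_br c x y) = {[frame_map x, frame_map y]}.
Proof.
have uB f v : {[qe_u f, v]} = 0 := qe_j_br v (qe_u_j f).
have Bu f v : {[v, qe_u f]} = 0 by rewrite lie_brC uB oppr0.
rewrite /frame_map /std_br /= linear0 addr0.
rewrite !(linearDl, linearDr) /= !uB !Bu !(add0r, addr0).
rewrite (lie_brC (t _) (s _)) frame_br_tt !frame_br_st frame_br_ss.
apply: scalar_inj => f.
have fD u v : f (u + v) = f u + f v by exact: linearD.
have fN u : f (- u) = - f u by exact: linearN.
by rewrite !(fD, fN); ring.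
Qed.

(** The right-hand side is [std_omega] written out, since [std_omega] lives on [std_lie], which
    presupposes a cocycle. *)
Lemma frame_map_omega x y : omega (frame_map x) (frame_map y) =
  x.1.1 y.2 + omega x.1.2 y.1.2 - y.1.1 x.2.
Proof.
rewrite /frame_map !(omegaDl, omegaDr).
rewrite !(omegaC (t _) (qe_u _)) !(omegaC (s _) (qe_u _)) !frame_ut !frame_us.
rewrite (omegaC (s _) (t _)) !(frame_ts ts) (frame_ss ts) frame_tt qe_uE.
by rewrite qe_q_u linear0; ring.
Qed.

(** Applying q gives L = 0; since [frame_map] respects the forms, pairing with l and a then kills
    the other two components. *)
Lemma frame_map_eq0 (x : D) : frame_map x = 0 -> x = 0.
Proof.
move=> x0; have xE (y : D) : x.1.1 y.2 + omega x.1.2 y.1.2 - y.1.1 x.2 = 0.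
  by have := frame_map_omega x y; rewrite x0 omega0l => <-.
have /eqP q0 : qe_q (frame_map x) = 0 by rewrite x0 linear0.
move: q0; rewrite /frame_map !linearD /= qe_q_u frame_qt (frame_s ts) !add0r.
case: x xE {x0} => [[f A] L] /= xE /eqP L0.
rewrite L0 in xE *.
congr (_, _, _).
  apply/lfunP => L'; have := xE (0, 0, L').
  by rewrite /= omega0r !zero_lfunE addr0 subr0.
apply: omega_inj => A'; have := xE (0, A', 0).
by rewrite /= zero_lfunE linear0 subr0 add0r omega0l.
Qed.

Lemma frame_map_inj : injective frame_map.
Proof.
move=> x y xy; apply/eqP; rewrite -subr_eq0; apply/eqP/frame_map_eq0.
by rewrite -scaleN1r addrC frame_map_linear xy scaleN1r addNr.
Qed.

Lemma frame_map_surj y : exists x, frame_map x = y.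
Proof. by have [f [A yE]] := frame_decomp y; exists (f, A, qe_q y). Qed.

Lemma frame_mapD (x y : D) : frame_map (x + y) = frame_map x + frame_map y.
Proof. by rewrite -[x]scale1r frame_map_linear !scale1r. Qed.

(** [std_br] makes sense for any cochain, and [frame_map] embeds it into the bracket of g, so it
    inherits the Jacobi identity. *)
Lemma frame_jacobi (x y z : D) :
  std_br c x (std_br c y z) + std_br c y (std_br c z x)
    + std_br c z (std_br c x y) = 0.
Proof.
by apply: frame_map_eq0; rewrite !frame_mapD !frame_map_br lie_jacobi.
Qed.

(** The conditions on gamma and xi are the components of the Jacobi identity on triples of type (L,
    A, A), (L, L, A) and (L, L, L). Those on epsilon come from alternation of the bracket and
    closedness of omega. *)
Lemma frame_Z2 : Z2 c.
Proof.
have betaC A1 A2 : beta c A1 A2 = - beta c A2 A1.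
  apply/lfunP => L; rewrite opp_lfunE !betaE (omegaC A1) (omegaC (xi c L A1)).
  by ring.
have br0 (A : a) : {[0, A]} = 0 by exact: linear0l.
have b0r (A : a) : {[A, 0]} = 0 by exact: linear0r.
have LAA L A1 A2 := frame_jacobi (0, 0, L) (0, A1, 0) (0, A2, 0).
have LLA L1 L2 A := frame_jacobi (0, 0, L1) (0, 0, L2) (0, A, 0).
have LLL L1 L2 L3 := frame_jacobi (0, 0, L1) (0, 0, L2) (0, 0, L3).
pose zE := (linear0, @zero_lfunE, br0, b0r, subr0, sub0r, addr0, add0r).
split=> [L|L A1 A2|L1 L2|L1 L2 L3|L A1 A2|L1 L2 A|L1 L2 L3|L1 L2 L3].
- by apply/lfunP => L'; rewrite (fc_eps tsc) lie_brxx omega0l zero_lfunE.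
- have := congr1 (fun x : D => x.1.2) (LAA L A1 A2).
  rewrite /std_br /= !zE linearNr /= (lie_brC A2) -addrA -opprD => /eqP.
  by rewrite subr_eq0 => /eqP->; rewrite addrC.
- apply/lfunP => A; have := congr1 (fun x : D => x.1.2) (LLA L1 L2 A).
  rewrite /std_br /= !zE linearN /= (lie_brC A) => /eqP.
  rewrite subr_eq0 => /eqP h.
  by rewrite add_lfunE opp_lfunE !comp_lfunE lie_adE.
- have := congr1 (fun x : D => x.1.2) (LLL L1 L2 L3).
  by rewrite /std_br /= !zE.
- have := congr1 (fun x : D => x.1.1) (LAA L A1 A2).
  rewrite /std_br /= !zE linearN /= (betaC A2) -addrA -opprD => /eqP.
  by rewrite subr_eq0 => /eqP->; rewrite addrC.
- have := congr1 (fun x : D => x.1.1) (LLA L1 L2 A).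
  rewrite /std_br /= !zE linearN /= (betaC A) => h.
  by apply/eqP; rewrite -oppr_eq0 opprD opprB h.
- have := congr1 (fun x : D => x.1.1) (LLL L1 L2 L3).
  by rewrite /std_br /= !zE.
- by rewrite !(fc_eps tsc) omega_closed.
Qed.

End FrameTheory.
End Extension.
End Frames.

(** * Equivalence of extensions and invariance of balancedness *)

Section Equivalence.
Variables (R : realType) (l : lieAlg R) (a : sympLie R).
Implicit Types E : quadExt l a.

(** Computes the induced map on representatives, so that later arguments take place in g instead of
    g/j. *)
Lemma qe_equivP E1 E2 : qe_equiv E1 E2 <->
  exists Phi : 'Hom(qe_g E1, qe_g E2),
    [/\ symp_iso Phi, (Phi @: qe_j E1)%VS = qe_j E2,
        forall A x, lie_proj (qe_j E1) x = qe_i E1 A ->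
          lie_proj (qe_j E2) (Phi x) = qe_i E2 A &
        forall x, qe_q E2 (Phi x) = qe_q E1 x].
Proof.
have bar (Phi : 'Hom(qe_g E1, qe_g E2)) x : (Phi @: qe_j E1)%VS = qe_j E2 ->
    vquot_desc (qe_j E1) (lie_proj (qe_j E2) \o Phi)%VF (lie_proj (qe_j E1) x)
      = lie_proj (qe_j E2) (Phi x).
  move=> Phij; rewrite vquot_descE ?comp_lfunE//; apply/subvP => y yj.
  by rewrite memv_ker comp_lfunE lie_proj_eq0 -Phij memv_img.
split=> -[Phi].
  case=> iso Phij /= [ii pp]; exists Phi; split=> // [A x xA|x].
    by rewrite -bar// xA -ii comp_lfunE.
  by rewrite !qe_qE -pp comp_lfunE bar.
case=> iso Phij ii pp; exists Phi; split=> //=; split; apply/lfunP => y.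
  have [x xy] := lie_projP (qe_i E1 y).
  by rewrite comp_lfunE xy bar//; apply: ii.
by have [x ->] := lie_projP y; rewrite comp_lfunE bar// -!qe_qE.
Qed.

Lemma symp_iso_inv (g h : sympLie R) (f : 'Hom(g, h)) :
  symp_iso f ->
  [/\ cancel f (f^-1)%VF, cancel (f^-1)%VF f & symp_iso (f^-1)%VF].
Proof.
move=> [[f' fK f'K] fbr fom].
have fk : cancel f (f^-1)%VF.
  by apply: lker0_lfunK; apply/lker0P; apply: can_inj fK.
have fk' : cancel (f^-1)%VF f.
  by move=> x; rewrite limg_lfunVK// -[x]f'K memv_img ?memvf.
split=> //; split=> [|x y|x y]; first by exists f.
  by rewrite -[x in LHS]fk' -[y in LHS]fk' -fbr fk.
by rewrite -fom !fk'.
Qed.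

Lemma qe_equiv_refl E : qe_equiv E E.
Proof.
apply/qe_equivP; exists \1%VF; split=> [||A x|x]; rewrite ?lim1g ?id_lfunE//.
split=> [|x y|x y]; rewrite ?id_lfunE//.
by exists id => x; rewrite id_lfunE.
Qed.

Lemma qe_equiv_sym E1 E2 : qe_equiv E1 E2 -> qe_equiv E2 E1.
Proof.
move=> /qe_equivP[Phi [iso Phij ii pp]]; apply/qe_equivP.
have [PhiK Phi'K iso'] := symp_iso_inv iso.
exists (Phi^-1)%VF; split=> // [|A x xA|x]; last by rewrite -pp Phi'K.
  apply/vspaceP => x; rewrite -Phij; apply/memv_imgP/idP => [[y]|xj].
    by move=> /memv_imgP[z zj -> ->]; rewrite PhiK.
  by exists (Phi x); rewrite ?PhiK// memv_img.
have [y yA] := lie_projP (qe_i E1 A).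
(* Phi y and x agree modulo the second ideal, which is the image of the first, so y and the preimage
   of x agree modulo the first. *)
have /eqP := ii _ _ (esym yA); rewrite -xA -subr_eq0 -linearB /= lie_proj_eq0.
rewrite -Phij => /memv_imgP[z zj Phiz].
rewrite yA; apply/eqP; rewrite eq_sym -subr_eq0 -linearB lie_proj_eq0.
suff -> : y - (Phi^-1)%VF x = z by [].
by rewrite -[y]PhiK -linearB /= Phiz PhiK.
Qed.

Lemma qe_equiv_trans E1 E2 E3 :
  qe_equiv E1 E2 -> qe_equiv E2 E3 -> qe_equiv E1 E3.
Proof.
move=> /qe_equivP[Phi [iso Phij ii pp]] /qe_equivP[Psi [iso' Psij ii' pp']].
apply/qe_equivP; exists (Psi \o Phi)%VF; split=> [||A x|x].
- case: iso iso' => [bij br om] [bij' br' om'].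
  split=> [|x y|x y]; last by rewrite !comp_lfunE om' om.
    apply: (eq_bij (bij_comp bij' bij)) => x.
    by rewrite comp_lfunE.
  by rewrite !comp_lfunE br br'.
- by rewrite limg_comp Phij Psij.
- by rewrite comp_lfunE => /ii/ii'.
- by rewrite comp_lfunE pp' pp.
Qed.

Lemma qe_class_eq E1 E2 : qe_class E1 = qe_class E2 <-> qe_equiv E1 E2.
Proof.
split=> [e|e12]; last first.
  apply: functional_extensionality_dep => E; apply: propext; split=> e.
    exact: qe_equiv_trans (qe_equiv_sym e12) e.
  exact: qe_equiv_trans e12 e.
by have : qe_class E2 E2 by [apply: qe_equiv_refl]; rewrite -e.
Qed.

Lemma balanced_equiv E1 E2 : qe_equiv E1 E2 -> balanced E1 -> balanced E2.
Proof.
move=> /qe_equivP[Phi [iso Phij _ _]] b1.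
have [PhiK Phi'K [_ br' om']] := symp_iso_inv iso.
case: iso => [_ br om].
have zE x : (Phi x \in lie_center (qe_g E2)) = (x \in lie_center (qe_g E1)).
  apply/lie_centerP/lie_centerP => xz y.
    by rewrite -[x]PhiK -[y]PhiK -br' xz linear0.
  by rewrite -[y]Phi'K -br xz linear0.
have zpE x : (Phi x \in perp (lie_center (qe_g E2)))
    = (x \in perp (lie_center (qe_g E1))).
  apply/mem_orthovP/mem_orthovP => xz y yz.
    by rewrite -om xz// zE.
  by rewrite -[y]Phi'K om xz// -zE Phi'K.
rewrite /balanced -Phij b1; apply/vspaceP => x.
rewrite -[x]Phi'K memv_cap zE zpE -memv_cap.
apply/memv_imgP/idP => [[y yz /(can_inj PhiK)->]//|xz].
by exists ((Phi^-1)%VF x).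
Qed.

End Equivalence.

(** * Frames of d_c and the action of Hom(l, a) *)

Section StandardFrames.
Variables (R : realType) (l : lieAlg R) (a : sympLie R).
Hypothesis l_abelian : lie_abelian l.

Lemma cochain_eq (c c' : cochain l a) :
  (forall L A L', gam c L A L' = gam c' L A L') ->
  (forall L1 L2 L3, eps c L1 L2 L3 = eps c' L1 L2 L3) ->
  (forall L A, xi c L A = xi c' L A) -> c = c'.
Proof.
case: c c' => [gm ep x] [gm' ep' x'] /= eg ee ex.
congr Cochain; apply/lfunP => L; apply/lfunP => ?; do ?[apply/lfunP => ?];
  by [apply: eg | apply: ee | apply: ex].
Qed.

Variables (c : cochain l a) (cZ : Z2 c).
Local Notation D := (std_symp cZ).
Local Notation E := (std_ext l_abelian cZ).

Lemma mem_std_ideal (x : D) :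
  (x \in std_ideal cZ) = (x.1.2 == 0) && (x.2 == 0).
Proof.
have inE Z : linfun (fun Z => (Z, 0, 0) : D) Z = (Z, 0, 0).
  by apply: linfunE => k u v; congr (_, _, _); rewrite /= scaler0 addr0.
apply/memv_imgP/andP => [[Z _ ->]|[/eqP x2 /eqP x3]]; first by rewrite inE.
exists x.1.1; first exact: memvf.
by rewrite inE; case: x x2 x3 => [[? ?] ?] /= -> ->.
Qed.

Lemma std_qE (x : D) : qe_q E x = x.2.
Proof.
rewrite qe_qE [LHS]vquot_descE; first exact: linfunE.
apply/subvP => y; rewrite mem_std_ideal memv_ker => /andP[_ /eqP y0].
by rewrite linfunE// y0.
Qed.

Definition std_inA : 'Hom(a, D) := linfun (fun A => (0, A, 0) : D).

Lemma std_inAE A : std_inA A = (0, A, 0).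
Proof.
by apply: linfunE => k u v; congr (_, _, _); rewrite /= scaler0 addr0.
Qed.

Definition std_inL : 'Hom(l, D) := linfun (fun L => (0, 0, L) : D).

Lemma std_inLE L : std_inL L = (0, 0, L).
Proof.
apply: linfunE => k u v; congr (_, _); congr (_, _);
  by rewrite /= scaler0 addr0.
Qed.

Lemma std_iE A : qe_i E A = lie_proj (std_ideal cZ) (0, A, 0).
Proof. by rewrite -std_inAE; apply: comp_lfunE. Qed.

Lemma std_projE (x y : D) :
  (lie_proj (std_ideal cZ) x == lie_proj (std_ideal cZ) y) =
  (x.1.2 == y.1.2) && (x.2 == y.2).
Proof.
by rewrite -subr_eq0 -linearB lie_proj_eq0 mem_std_ideal /= !subr_eq0.
Qed.

Lemma std_frame : @frame _ _ _ E std_inA std_inL.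
Proof.
split=> [A|L|A L|L L'].
- by rewrite std_iE std_inAE.
- by rewrite std_qE std_inLE.
- rewrite std_inAE std_inLE /= /std_omega /=.
  by rewrite zero_lfunE omega0r zero_lfunE !addr0 subr0.
- rewrite !std_inLE /= /std_omega /=.
  by rewrite !zero_lfunE omega0r !addr0 subr0.
Qed.

Lemma std_frame_cochain : @frame_cochain _ _ _ E std_inA std_inL c.
Proof.
split=> [L A L'|L1 L2 L3|L A A'];
  rewrite ?std_inAE ?std_inLE /= /std_omega /std_br /=;
  by rewrite !(omega0r, linear0, zero_lfunE, @linear0l _ _ _ _ _ _ (lie_br a),
       addr0, add0r, subr0).
Qed.

(** The bracket of d_c ignores l^*-components and has no l-component. So only the parts A of t A and
    -tau L + L of s L enter c', and expanding gives the formulas of the action. *)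
Lemma frame_std_act (t : 'Hom(a, D)) (s : 'Hom(l, D)) (tau : 'Hom(l, a)) c' :
  @frame _ _ _ E t s -> @frame_cochain _ _ _ E t s c' ->
  (forall L, tau L = - (s L).1.2) -> c' = act c tau.
Proof.
move=> ts tsc tauE.
have s2 L : (s L).2 = L by rewrite -std_qE (frame_s ts).
have sA L : (s L).1.2 = - tau L by rewrite tauE opprK.
have t12 A : (t A).1.2 = A /\ (t A).2 = 0.
  have /eqP := frame_t ts A; rewrite std_iE std_projE /=.
  by move=> /andP[/eqP ? /eqP ?].
have tA A := (t12 A).1; have t0 A := (t12 A).2.
have brNl (x y : a) : {[- x, y]} = - {[x, y]} by exact: linearNl.
have brNr (x y : a) : {[x, - y]} = - {[x, y]} by exact: linearNr.
have gamN L A : gam c L (- A) = - gam c L A by exact: linearN.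
have xiN L A : xi c L (- A) = - xi c L A by exact: linearN.
have betaN A A' : beta c (- A) A' = - beta c A A' by rewrite linearN opp_lfunE.
have betaNN A A' : beta c (- A) (- A') = beta c A A'.
  by rewrite betaN linearN /= opprK.
pose om := (omegaNl, omegaNr, omegaDl, omegaDr).
apply: cochain_eq => [L A L'|L1 L2 L3|L A].
- rewrite (fc_gam tsc) act_gamE /act_gam /= /std_omega /std_br /=.
  rewrite !sA !tA !s2 !t0 !brNl betaN !linear0 !zero_lfunE !addr0 !subr0.
  rewrite !(add_lfunE, opp_lfunE) !tau_starE (omegaC _ (- tau L')) !om; ring.
- rewrite (fc_eps tsc) act_epsE /act_eps /= /std_omega /std_br /=.
  rewrite !sA !s2 brNl brNr opprK betaNN !gamN !xiN linear0.
  rewrite !(add_lfunE, opp_lfunE) !tau_starE (omegaC _ (- tau L3)) !om; ring.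
- apply: omega_inj => A'.
  rewrite (fc_xi tsc) act_xiE /act_xi /= /std_omega /std_br /=.
  rewrite !sA !tA !s2 !t0 !brNl !linear0 !zero_lfunE !addr0 !subr0 !om.
  by ring.
Qed.

(** Every tau occurs, so by [frame_std_act] every [act c tau] is the cochain of a frame of d_c. *)
Lemma ex_frame_std (tau : 'Hom(l, a)) : exists t s,
  @frame _ _ _ E t s /\ forall L, tau L = - (s L : D).1.2.
Proof.
(* The l^*-components restore the frame conditions: -tau^* makes t orthogonal to s, and [k], skew
   and counted twice in [omega (s L) (s L')], makes s isotropic. *)
pose k := bilin (fun L L' => - (omega (tau L) (tau L') / 2) : R^o).
have kE L L' : k L L' = - (omega (tau L) (tau L') / 2).
  apply: bilinE; split=> z r u v.
    by rewrite linearP linearPl /= !regE; ring.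
  by rewrite linearP linearPr /= !regE; ring.
pose t : 'Hom(a, D) := linfun (fun A => (- tau_star tau A, A, 0) : D).
pose s : 'Hom(l, D) := linfun (fun L => (k L, - tau L, L) : D).
have tE A : t A = (- tau_star tau A, A, 0).
  apply: linfunE => r u v; congr (_, _, _); last by rewrite /= scaler0 addr0.
  by rewrite linearP /= opprD scalerN.
have sE L : s L = (k L, - tau L, L).
  apply: linfunE => r u v; congr (_, _, _); rewrite linearP//=.
  by rewrite opprD scalerN.
exists t, s; split=> [|L]; last by rewrite sE opprK.
split=> [A|L|A L|L L'].
- by rewrite std_iE tE; apply/eqP; rewrite std_projE !eqxx.
- by rewrite std_qE sE.
- rewrite tE sE /= /std_omega /= opp_lfunE tau_starE linear0 omegaNr (omegaC A).
  by rewrite opprK addNr subr0.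
- rewrite !sE /= /std_omega /= !kE omegaNl omegaNr (omegaC (tau L')).
  by field.
Qed.

End StandardFrames.

(** * Orbits of cocycles versus equivalence classes *)

Section Classification.
Variables (R : realType) (l : lieAlg R) (a : sympLie R).
Hypothesis l_abelian : lie_abelian l.

(** In the coordinates of the frame, g has the bracket and form of d_c: [frame_map] is the
    equivalence. *)
Lemma frame_equiv (E : quadExt l a) (t : 'Hom(a, qe_g E)) (s : 'Hom(l, qe_g E))
    (c : cochain l a) (cZ : Z2 c) :
  frame t s -> frame_cochain t s c -> qe_equiv (std_ext l_abelian cZ) E.
Proof.
move=> ts tsc; apply/qe_equivP.
pose Phi : 'Hom(std_symp cZ, qe_g E) := linfun (frame_map t s).
have PhiE x : Phi x = frame_map t s x by apply/linfunE/frame_map_linear.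
have qPhi x : qe_q E (Phi x) = x.2.
  rewrite PhiE /frame_map !linearD /= qe_q_u (frame_qt ts) (frame_s ts).
  by rewrite !add0r.
have piPhi (x : std_symp cZ) : x.2 = 0 ->
    lie_proj (qe_j E) (Phi x) = qe_i E x.1.2.
  move=> x0; rewrite PhiE /frame_map x0 linear0 addr0 linearD /= (frame_t ts).
  by move: (qe_u_j E x.1.1); rewrite -lie_proj_eq0 => /eqP->; rewrite add0r.
have inj : injective Phi.
  by move=> x y; rewrite !PhiE; apply: frame_map_inj.
have surj y : exists x, Phi x = y.
  by have [x xy] := frame_map_surj ts y; exists x; rewrite PhiE.
exists Phi; split=> [||A x|x]; last by rewrite qPhi std_qE.
- split=> [|x y|x y]; last by rewrite !PhiE (frame_map_omega ts).
    exists (Phi^-1)%VF => [|y]; first exact/lker0_lfunK/lker0P.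
    by have [x <-] := surj y; rewrite limg_lfunVK// memv_img ?memvf.
  by rewrite !PhiE (frame_map_br l_abelian ts tsc).
- apply/vspaceP => y; apply/memv_imgP/idP => [[x]|yj].
    rewrite mem_std_ideal => /andP[/eqP x2 /eqP x0] ->.
    by rewrite -lie_proj_eq0 piPhi// x2 linear0.
  have [x xy] := surj y; exists x => //; rewrite mem_std_ideal.
  have /eqP x0 : x.2 = 0.
    rewrite -qPhi xy; apply/eqP; rewrite -qe_q_perp.
    exact: (subvP (qe_j_isotropic E)).
  rewrite x0 andbT; apply/eqP/(@qe_i_inj _ _ _ E).
  by rewrite -piPhi ?(eqP x0)// linear0; apply/eqP; rewrite xy lie_proj_eq0.
- rewrite std_iE => /eqP; rewrite std_projE /= => /andP[/eqP <- /eqP x0].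
  exact: piPhi.
Qed.

(** An equivalence respects i, q, bracket and omega, hence the frame conditions and the numbers that
    define c. *)
Lemma equiv_frame (E1 E2 : quadExt l a) (t : 'Hom(a, qe_g E1))
    (s : 'Hom(l, qe_g E1)) (c : cochain l a) :
  qe_equiv E1 E2 -> frame t s -> frame_cochain t s c ->
  exists (t' : 'Hom(a, qe_g E2)) (s' : 'Hom(l, qe_g E2)),
    frame t' s' /\ frame_cochain t' s' c.
Proof.
move=> /qe_equivP[Phi [[_ br om] _ ii pp]] ts tsc.
have tE A : (Phi \o t)%VF A = Phi (t A) by rewrite comp_lfunE.
have sE L : (Phi \o s)%VF L = Phi (s L) by rewrite comp_lfunE.
exists (Phi \o t)%VF, (Phi \o s)%VF; split.
  split=> [A|L|A L|L L']; rewrite ?tE ?sE ?om.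
  - exact/ii/(frame_t ts).
  - by rewrite pp (frame_s ts).
  - exact: (frame_ts ts).
  - exact: (frame_ss ts).
by split=> [L A L'|L1 L2 L3|L A A']; rewrite ?tE ?sE -br om;
  [exact: (fc_gam tsc) | exact: (fc_eps tsc) | exact: (fc_xi tsc)].
Qed.

Lemma ex_std_equiv (E : quadExt l a) :
  exists c (cZ : Z2 c), qe_equiv (std_ext l_abelian cZ) E.
Proof.
have [t [s ts]] := ex_frame E.
have [c tsc] := ex_frame_cochain t s.
by exists c, (frame_Z2 l_abelian ts tsc); apply: frame_equiv ts tsc.
Qed.

(** The canonical frame of d_c', carried over to d_c, still has cochain c', which [frame_std_act]
    recognises as a translate of c. *)
Lemma std_equiv_act (c c' : cochain l a) (cZ : Z2 c) (cZ' : Z2 c') :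
  qe_equiv (std_ext l_abelian cZ') (std_ext l_abelian cZ) ->
  exists tau, c' = act c tau.
Proof.
move=> /equiv_frame/(_ (std_frame l_abelian cZ')).
move=> /(_ _ (std_frame_cochain l_abelian cZ'))[t [s [ts tsc]]].
pose tau : 'Hom(l, a) := linfun (fun L => - (s L : std_symp cZ).1.2).
exists tau; apply: (frame_std_act ts tsc) => L.
by apply: linfunE => k x y; rewrite linearP /= opprD scalerN.
Qed.

(** As the cochain of a frame of d_c, [act c tau] satisfies [frame_Z2] and [frame_equiv]; invariance
    of [Z2] under the action is a by-product. *)
Lemma std_act_equiv (c : cochain l a) (cZ : Z2 c) tau :
  exists cZ' : Z2 (act c tau),
    qe_equiv (std_ext l_abelian cZ') (std_ext l_abelian cZ).
Proof.
have [t [s [ts tauE]]] := ex_frame_std l_abelian cZ tau.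
have [c' tsc] := ex_frame_cochain t s.
have <- := frame_std_act ts tsc tauE.
by exists (frame_Z2 l_abelian ts tsc); apply: frame_equiv ts tsc.
Qed.

Lemma cclass_eq (c c' : cochain l a) (cZ : Z2 c) (cZ' : Z2 c') :
  cclass c = cclass c' <->
  qe_equiv (std_ext l_abelian cZ) (std_ext l_abelian cZ').
Proof.
have sub (c1 c2 : cochain l a) (cZ1 : Z2 c1) (cZ2 : Z2 c2) :
    qe_equiv (std_ext l_abelian cZ1) (std_ext l_abelian cZ2) ->
    forall d, cclass c1 d -> cclass c2 d.
  move=> e d [tau ->]; have [dZ de] := std_act_equiv cZ1 tau.
  exact: std_equiv_act (qe_equiv_trans de e).
split=> [cc|e]; last first.
  apply: functional_extensionality_dep => d; apply: propext; split.
    exact: sub e d.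
  exact: sub (qe_equiv_sym e) d.
(* Reflexivity of equivalence puts c in its own class, in place of the identity law of the
   action. *)
have [tau ctau] : cclass c' c.
  by rewrite -cc; apply: std_equiv_act (qe_equiv_refl (std_ext l_abelian cZ)).
rewrite ctau in cZ *.
have [cZ1] := std_act_equiv cZ' tau.
by rewrite (Prop_irrelevance cZ1 cZ).
Qed.

(** * The center of d_c and balancedness *)

Section Balanced.
Variables (c : cochain l a) (cZ : Z2 c).
Local Notation D := (std_symp cZ).

(** Since l^* is central, it suffices to commute with a and l; the components of these brackets are
    the equations of [Z2sharp_a]. *)
Lemma std_centerP (x : D) : (x \in lie_center D) <->
  [/\ lie_ad a x.1.2 + xi c x.2 = 0, gam c x.2 + beta c x.1.2 = 0,
      forall L, alpha c x.2 L = xi c L x.1.2 &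
      forall L, eps c x.2 L = gam c L x.1.2].
Proof.
split=> [/lie_centerP xz|[xi0 gam0 alE epE]].
  have zA A : beta c x.1.2 A + gam c x.2 A = 0 /\ {[x.1.2, A]} + xi c x.2 A = 0.
    have := xz (0, A, 0); rewrite /= /std_br /=.
    by rewrite !linear0 !zero_lfunE !subr0 !addr0 => -[].
  have zL L :
      eps c x.2 L - gam c L x.1.2 = 0 /\ alpha c x.2 L - xi c L x.1.2 = 0.
    have := xz (0, 0, L); rewrite /= /std_br /=.
    rewrite !linear0 !add0r => -[e1 e2].
    by rewrite addrC e1 addrC e2.
  split=> [||L|L]; last 2 first.
  - by apply/eqP; rewrite -subr_eq0 (zL L).2.
  - by apply/eqP; rewrite -subr_eq0 (zL L).1.
  - by apply/lfunP => A; rewrite add_lfunE lie_adE zero_lfunE (zA A).2.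
  - by apply/lfunP => A; rewrite add_lfunE addrC zero_lfunE (zA A).1.
apply/lie_centerP => y; rewrite /= /std_br.
have := congr1 (fun f : 'Hom(_, _) => f y.1.2) xi0.
have := congr1 (fun f : 'Hom(_, _) => f y.1.2) gam0.
rewrite !add_lfunE !zero_lfunE lie_adE => g0 x0.
by rewrite alE epE !subrK x0 addrC g0.
Qed.

Lemma mem_std_perp_ideal (x : D) : (x \in perp (std_ideal cZ)) = (x.2 == 0).
Proof. by rewrite (qe_q_perp (E := std_ext l_abelian cZ)) std_qE. Qed.

(** Recognises the subspace of condition (b) as the a-components of central vectors in l^* + a. *)
Lemma std_center_aP (x : D) : x.2 = 0 -> (x \in lie_center D <->
  [/\ x.1.2 \in lie_center a, beta c x.1.2 = 0 &
      forall L, xi c L x.1.2 = 0 /\ gam c L x.1.2 = 0]).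
Proof.
move=> x0; rewrite std_centerP x0 !linear0 addr0 add0r memv_ker.
split=> [[-> -> al0 ep0]|[/eqP -> -> xg0]]; split=> // L.
- by rewrite -al0 -ep0 !zero_lfunE.
- by rewrite (xg0 L).1 zero_lfunE.
- by rewrite (xg0 L).2 zero_lfunE.
Qed.

Lemma balanced_std : balanced (std_ext l_abelian cZ) <-> Z2sharp c.
Proof.
split=> [bal|[_ ha hb]].
  have jz : std_ideal cZ = (lie_center D :&: perp (lie_center D))%VS
    :> {vspace _} := bal.
  (* Balancedness makes l^* orthogonal to the center, so the center lies in l^* + a; this is
     condition (a). *)
  have z0 (x : D) : x \in lie_center D -> x.2 = 0.
    move=> xz; apply/eqP; rewrite -mem_std_perp_ideal; apply/mem_orthovP => y.
    rewrite jz memv_cap => /andP[_ /mem_orthovP yz].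
    by rewrite omegaC yz// oppr0.
  split=> // [L [A LA]|P A PA AP].
    by apply: (z0 (0, A, L)); apply/std_centerP.
  (* A vector A in the radical of the subspace of (b) is central and orthogonal to the center, hence
     in l^*, so it vanishes. *)
  suff : ((0, A, 0) : D) \in std_ideal cZ.
    by rewrite mem_std_ideal => /andP[/eqP].
  rewrite jz memv_cap (std_center_aP (x := (0, A, 0)) erefl).2//=.
  apply/mem_orthovP => y yz; have y0 := z0 y yz.
  rewrite /= /std_omega /= y0 zero_lfunE linear0 subr0 add0r.
  by apply: AP; apply/(std_center_aP y0).
have z0 (x : D) : x \in lie_center D -> x.2 = 0.
  by move/std_centerP => xz; apply: ha; exists x.1.2.
apply/vspaceP => x; rewrite mem_std_ideal memv_cap; apply/andP/andP.
  case=> /eqP x2 /eqP x0; split.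
    apply/(std_center_aP x0); rewrite x2 linear0 mem0v; split=> // L.
    by rewrite !linear0.
  apply/mem_orthovP => y yz.
  by rewrite /= /std_omega x2 x0 (z0 _ yz) !linear0 omega0l !addr0.
case=> xz /mem_orthovP xp; have x0 := z0 _ xz; rewrite x0 eqxx; split=> //.
(* The a-component of a central vector orthogonal to the center lies in the radical of the subspace
   of (b). *)
apply/eqP/hb; first exact/(std_center_aP x0).
move=> B PB; have := xp (0, B, 0).
rewrite (std_center_aP (x := (0, B, 0)) erefl).2//= => /(_ isT).
by rewrite /std_omega /= linear0 zero_lfunE add0r subr0.
Qed.

End Balanced.
End Classification.

Theorem theorem5 (R : realType) (l : lieAlg R) (a : sympLie R)
    (l_abelian : lie_abelian l) :
  exists F : (cochain l a -> Prop) -> (quadExt l a -> Prop),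
    [/\ forall (c : cochain l a) (cZ : Z2 c),
          F (cclass c) = qe_class (std_ext l_abelian cZ),
        bij_onto (@H2 R l a) (@qe_classes R l a) F &
        bij_onto (@H2sharp R l a) (@balanced_classes R l a) F].
Proof.
(* Quantifying over all cocycles representing C avoids choosing one; off [H2] the value is the empty
   predicate. *)
exists (fun C E => exists c (cZ : Z2 c),
  C = cclass c /\ qe_equiv (std_ext l_abelian cZ) E).
set F := fun C => _.
have FE c (cZ : Z2 c) : F (cclass c) = qe_class (std_ext l_abelian cZ).
  apply: functional_extensionality_dep => E; apply: propext; split.
    move=> [c' [cZ' [/(cclass_eq l_abelian cZ cZ')]]].
    exact: qe_equiv_trans.
  by exists c, cZ.
have Finj C C' : H2 C -> H2 C' -> F C = F C' -> C = C'.
  move=> [c [cZ ->]] [c' [cZ' ->]]; rewrite !FE => /qe_class_eq.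
  by move/(cclass_eq l_abelian cZ cZ').
split=> //; split=> //.
- by move=> _ [c [cZ ->]]; rewrite FE; exists (std_ext l_abelian cZ).
- move=> _ [E ->]; have [c [cZ cE]] := ex_std_equiv l_abelian E.
  exists (cclass c); first by exists c.
  by rewrite FE; apply/qe_class_eq.
- move=> _ [c [cs ->]]; rewrite (FE _ (Z2sharp_Z2 cs)).
  by exists (std_ext l_abelian (Z2sharp_Z2 cs)); split=> //; apply/balanced_std.
- move=> C C' [c [cs ->]] [c' [cs' ->]].
  by apply: Finj; [exists c | exists c']; split=> //; apply: Z2sharp_Z2.
- move=> _ [E [bE ->]]; have [c [cZ cE]] := ex_std_equiv l_abelian E.
  exists (cclass c); last by rewrite FE; apply/qe_class_eq.
  (* Balancedness passes from E to the equivalent d_c, which puts c in [Z2sharp]. *)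
  exists c; split=> //; apply/(balanced_std l_abelian cZ).
  exact: balanced_equiv (qe_equiv_sym cE) bE.
Qed.
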